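(* Let $G$ be a finite Dedekind group (every subgroup of $G$ is normal). Then $G$ is Tambara finite; that is, for every finite $G$-set $X$ and every subgroup $L\leq G$, the commutative ring $\mathbb{A}[X](G/L)$ is a finitely generated $\mathbb{Z}$-algebra.
   Context: Let $G$ be a finite group. The category $\mathcal{P}_G$ of bispans (polynomials) of finite $G$-sets has finite $G$-sets as objects; a morphism $X\to Y$ is an isomorphism class of diagrams (called polynomials) $[X\xleftarrow{p}A\xrightarrow{q}B\xrightarrow{r}Y]$ of finite $G$-sets and $G$-maps, where an isomorphism of such diagrams is a pair of $G$-isomorphisms $A\cong A'$, $B\cong B'$ compatible with all maps and the identity on $X$ and $Y$. The composite of $[X\leftarrow A\to B\xrightarrow{r}Y]$ followed by $[Y\xleftarrow{p'}A'\xrightarrow{q'}B'\to Z]$ is $[X\leftarrow A''\to B''\to Z]$ with $B''=\{(b',s): b'\in B',\ s:q'^{-1}(b')\to B,\ r s=p'\}$, $W=B''\times_{B'}A'$, $W\to B$ given by $(a',s)\mapsto s(a')$, and $A''=W\times_B A$. A semi-Tambara functor is a product-preserving functor $\mathcal{P}_G\to\mathrm{Set}$ (products in $\mathcal{P}_G$ are disjoint unions of $G$-sets); its values are commutative semirings. It is a Tambara functor if its values are commutative rings. For a finite $G$-set $X$, the free polynomial Tambara functor $\mathbb{A}[X]$ is the additive completion (levelwise group completion) of the representable functor $\mathcal{P}_G(X,-)$. Explicitly, $\mathbb{A}[X](Y)$ is the group completion of the semiring $\mathcal{P}_G(X,Y)$ with $[X\leftarrow A\to B\to Y]+[X\leftarrow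 A'\to B'\to Y]=[X\leftarrow A\sqcup A'\to B\sqcup B'\to Y]$, $[X\leftarrow A\to B\to Y]\cdot[X\leftarrow A'\to B'\to Y]=[X\leftarrow (A\times_Y B')\sqcup(A'\times_Y B)\to B\times_Y B'\to Y]$, with $0=[X\leftarrow\varnothing\to\varnothing\to Y]$ and $1=[X\leftarrow\varnothing\to Y\to Y]$. *)

(* Defs.v *)
From HB Require Import structures.
From mathcomp Require Import all_boot all_order all_fingroup all_algebra.
From mathcomp Require Import boolp ring.

Set Implicit Arguments.
Unset Strict Implicit.
Unset Printing Implicit Defensive.

Import GRing.Theory.

(** * Finite G-sets

    Library actions are right actions, [act x (g * h) = act (act x g) h].
    A left G-set is the same thing as a right one via [x.g = g^-1.x]; under
    this correspondence the left cosets [G/L] become the right cosets below. *)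

Record gset (G : finGroupType) := GSet {
  gcarrier :> finType;
  gact : {action G &-> gcarrier}
}.

Record gmap (G : finGroupType) (X Y : gset G) := GMap {
  gfun :> X -> Y;
  gfunJ : forall x g, gfun (gact X x g) = gact Y (gfun x) g
}.

Section GSets.
Variable G : finGroupType.
Implicit Types X Y Z A B C : gset G.

Definition gid X : gmap X X := @GMap G X X id (fun _ _ => erefl).

Fact gcomp_subproof X Y Z (f : gmap X Y) (h : gmap Y Z) x g :
  h (f (gact X x g)) = gact Z (h (f x)) g.
Proof. by rewrite !gfunJ. Qed.
Definition gcomp X Y Z (f : gmap X Y) (h : gmap Y Z) : gmap X Z :=
  GMap (@gcomp_subproof X Y Z f h).

Definition gempty_act (x : void) (g : G) : void := x.
Fact gempty_act1 : gempty_act^~ 1%g =1 id. Proof. by []. Qed.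
Fact gempty_actM : forall x, act_morph gempty_act x. Proof. by []. Qed.
Definition gempty : gset G := GSet (TotalAction gempty_act1 gempty_actM).

Definition gfrom_empty X : gmap gempty X :=
  @GMap G gempty X (fun x : void => match x with end)
    (fun x : void => match x with end).

Definition gsum_act A B (x : A + B) (g : G) : A + B :=
  match x with inl a => inl (gact A a g) | inr b => inr (gact B b g) end.
Fact gsum_act1 A B : (@gsum_act A B)^~ 1%g =1 id.
Proof. by case=> x /=; rewrite act1. Qed.
Fact gsum_actM A B : forall x, act_morph (@gsum_act A B) x.
Proof. by case=> x g h /=; rewrite actM. Qed.
Definition gsum A B : gset G :=
  GSet (TotalAction (@gsum_act1 A B) (@gsum_actM A B)).

Definition gcase_fun A B X (f : A -> X) (h : B -> X) (x : gsum A B) : X :=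
  match x with inl a => f a | inr b => h b end.
Fact gcase_subproof A B X (f : gmap A X) (h : gmap B X) x g :
  gcase_fun f h (gact (gsum A B) x g) = gact X (gcase_fun f h x) g.
Proof. by case: x => x /=; rewrite gfunJ. Qed.
Definition gcase A B X (f : gmap A X) (h : gmap B X) : gmap (gsum A B) X :=
  GMap (@gcase_subproof A B X f h).

Definition ginl A B : gmap A (gsum A B) :=
  @GMap G A (gsum A B) inl (fun _ _ => erefl).
Definition ginr A B : gmap B (gsum A B) :=
  @GMap G B (gsum A B) inr (fun _ _ => erefl).

(** Fibre product of [f : A -> Y] and [h : B -> Y]. *)
Section Pullback.
Variables (A B Y : gset G) (f : gmap A Y) (h : gmap B Y).

Definition pb_type : finType := {u : A * B | f u.1 == h u.2}.

Fact pb_act_subproof (u : pb_type) (g : G) :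
  f (gact A (val u).1 g) == h (gact B (val u).2 g).
Proof. by case: u => u /= /eqP e; rewrite !gfunJ e. Qed.
Definition pb_act (u : pb_type) (g : G) : pb_type :=
  exist _ (gact A (val u).1 g, gact B (val u).2 g) (pb_act_subproof u g).
Fact pb_act1 : pb_act^~ 1%g =1 id.
Proof. by move=> [[a b] e]; apply: val_inj; rewrite /= !act1. Qed.
Fact pb_actM : forall x, act_morph pb_act x.
Proof. by move=> [[a b] e] g k; apply: val_inj; rewrite /= !actM. Qed.
Definition gpull : gset G := GSet (TotalAction pb_act1 pb_actM).

Definition gpull1 : gmap gpull A :=
  @GMap G gpull A (fun u => (val u).1) (fun _ _ => erefl).
Definition gpull2 : gmap gpull B :=
  @GMap G gpull B (fun u => (val u).2) (fun _ _ => erefl).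

Fact gpair_subproof1 X (k : gmap X A) (l : gmap X B)
  (e : forall x, f (k x) = h (l x)) x :
  f (k x, l x).1 == h (k x, l x).2.
Proof. exact/eqP/e. Qed.
Definition gpair_fun X (k : gmap X A) (l : gmap X B)
    (e : forall x, f (k x) = h (l x)) (x : X) : gpull :=
  exist _ (k x, l x) (gpair_subproof1 e x).
Fact gpair_subproof2 X (k : gmap X A) (l : gmap X B)
  (e : forall x, f (k x) = h (l x)) x g :
  gpair_fun e (gact X x g) = gact gpull (gpair_fun e x) g.
Proof. by apply: val_inj; rewrite /= !gfunJ. Qed.
Definition gpair X (k : gmap X A) (l : gmap X B)
    (e : forall x, f (k x) = h (l x)) : gmap X gpull :=
  GMap (gpair_subproof2 e).

End Pullback.

(** The orbit G/L. *)
Section Cosets.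
Variable L : {group G}.

Definition coset_type : finType := {C : {set G} | C \in rcosets L [set: G]}.

Fact coset_act_subproof (C : coset_type) (g : G) :
  (val C :* g)%g \in rcosets L [set: G].
Proof.
case: C => C /= /rcosetsP[x _ ->]; rewrite -rcosetM.
by apply/rcosetsP; exists (x * g)%g; rewrite ?inE.
Qed.
Definition coset_act (C : coset_type) (g : G) : coset_type :=
  exist _ (val C :* g)%g (coset_act_subproof C g).
Fact coset_act1 : coset_act^~ 1%g =1 id.
Proof. by move=> C; apply: val_inj; rewrite /= rcoset1. Qed.
Fact coset_actM : forall x, act_morph coset_act x.
Proof. by move=> C g h; apply: val_inj; rewrite /= rcosetM. Qed.
Definition gcosets : gset G := GSet (TotalAction coset_act1 coset_actM).

End Cosets.

End GSets.

(** * Bispans [X <-p- A -q-> B -r-> Y] *)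

Record bispan (G : finGroupType) (X Y : gset G) := Bispan {
  bA : gset G;
  bB : gset G;
  bp : gmap bA X;
  bq : gmap bA bB;
  br : gmap bB Y
}.

Definition bispan_iso (G : finGroupType) (X Y : gset G) (s t : bispan X Y) :=
  exists (f : gmap (bA s) (bA t)) (h : gmap (bB s) (bB t)),
    [/\ bijective f, bijective h,
        forall a, bp t (f a) = bp s a,
        forall a, bq t (f a) = h (bq s a)
      & forall b, br t (h b) = br s b].

Section Bispans.
Variables (G : finGroupType) (X Y : gset G).
Implicit Types s t u v : bispan X Y.

Definition bispan0 : bispan X Y :=
  Bispan (gfrom_empty X) (gid (gempty G)) (gfrom_empty Y).

Definition bispan1 : bispan X Y :=
  Bispan (gfrom_empty X) (gfrom_empty Y) (gid Y).

Definition bispan_add s t : bispan X Y :=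
  Bispan (gcase (bp s) (bp t))
         (gcase (gcomp (bq s) (ginl _ _)) (gcomp (bq t) (ginr _ _)))
         (gcase (br s) (br t)).

(** The fibre product [A x_Y B'], [A] lying over [Y] through [B]. *)
Definition bAB s t : gset G := gpull (gcomp (bq s) (br s)) (br t).

(** [(a, b') |-> (q a, b')] *)
Fact bAB_l_subproof s t (u : bAB s t) :
  br s (gcomp (gpull1 _ _) (bq s) u) = br t (gpull2 _ _ u).
Proof. exact/eqP/(valP u). Qed.
Definition bAB_l s t : gmap (bAB s t) (gpull (br s) (br t)) :=
  gpair (@bAB_l_subproof s t).

(** [(a', b) |-> (b, q' a')] *)
Fact bAB_r_subproof s t (u : bAB t s) :
  br s (gpull2 _ _ u) = br t (gcomp (gpull1 _ _) (bq t) u).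
Proof. exact/esym/eqP/(valP u). Qed.
Definition bAB_r s t : gmap (bAB t s) (gpull (br s) (br t)) :=
  gpair (@bAB_r_subproof s t).

Definition bispan_mul s t : bispan X Y :=
  Bispan (gcase (gcomp (gpull1 _ _) (bp s)) (gcomp (gpull1 _ _) (bp t)))
         (gcase (bAB_l s t) (bAB_r s t))
         (gcomp (gpull1 (br s) (br t)) (br s)).

End Bispans.

(** * The set P_G(X, Y) of isomorphism classes

    The finite G-sets do not form a type small enough to carry a choiceType
    structure, so a class is represented by bispans whose two middle objects
    have carriers ['I_n].  [bclass] is the class of an arbitrary bispan;
    [bclassP], [bclass_repr] identify the result with bispans up to
    isomorphism. *)

Section Skeleton.
Variable G : finGroupType.
Implicit Types A : gset G.

Definition skel_act A (i : 'I_#|A|) (g : G) : 'I_#|A| :=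
  enum_rank (gact A (enum_val i) g).
Fact skel_act1 A : (@skel_act A)^~ 1%g =1 id.
Proof. by move=> i; rewrite /skel_act act1 enum_valK. Qed.
Fact skel_actM A : forall x, act_morph (@skel_act A) x.
Proof. by move=> i g h; rewrite /skel_act enum_rankK actM. Qed.
Definition skel A : gset G :=
  GSet (TotalAction (@skel_act1 A) (@skel_actM A)).

Fact to_skel_subproof A x g :
  enum_rank (gact A x g) = gact (skel A) (enum_rank x) g.
Proof. by rewrite /= /skel_act enum_rankK. Qed.
Definition to_skel A : gmap A (skel A) :=
  @GMap G A (skel A) (@enum_rank A) (@to_skel_subproof A).

Fact of_skel_subproof A (i : skel A) g :
  enum_val (gact (skel A) i g) = gact A (enum_val i) g.
Proof. by rewrite /= /skel_act enum_rankK. Qed.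
Definition of_skel A : gmap (skel A) A :=
  @GMap G (skel A) A (@enum_val _ A) (@of_skel_subproof A).

End Skeleton.

Record ord_bispan (G : finGroupType) (X Y : gset G) := OrdBispan {
  obm : nat;
  obn : nat;
  obA : {action G &-> 'I_obm};
  obB : {action G &-> 'I_obn};
  obp : gmap (GSet obA) X;
  obq : gmap (GSet obA) (GSet obB);
  obr : gmap (GSet obB) Y
}.

HB.instance Definition _ (G : finGroupType) (X Y : gset G) :=
  gen_eqMixin (ord_bispan X Y).
HB.instance Definition _ (G : finGroupType) (X Y : gset G) :=
  gen_choiceMixin (ord_bispan X Y).

Definition bispan_of (G : finGroupType) (X Y : gset G) (o : ord_bispan X Y) :
  bispan X Y := Bispan (obp o) (obq o) (obr o).

Definition ord_of (G : finGroupType) (X Y : gset G) (s : bispan X Y) :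
    ord_bispan X Y :=
  @OrdBispan G X Y _ _ (gact (skel (bA s))) (gact (skel (bB s)))
    (gcomp (of_skel (bA s)) (bp s))
    (gcomp (of_skel (bA s)) (gcomp (bq s) (to_skel (bB s))))
    (gcomp (of_skel (bB s)) (br s)).

Section IsoTheory.
Variables (G : finGroupType) (X Y : gset G).
Implicit Types s t u v : bispan X Y.

Lemma bispan_iso_refl s : bispan_iso s s.
Proof. by exists (gid _), (gid _); split=> //; exists id. Qed.

Lemma bij_gmap_inv (A B : gset G) (f : gmap A B) :
  bijective f -> exists k : gmap B A, cancel f k /\ cancel k f.
Proof.
case=> k fK kK.
have kJ y g : k (gact B y g) = gact A (k y) g.
  by apply: (can_inj fK); rewrite gfunJ !kK.
by exists (GMap kJ).
Qed.

Lemma bispan_iso_sym s t : bispan_iso s t -> bispan_iso t s.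
Proof.
case=> f [h] [/bij_gmap_inv[f' [fK f'K]] /bij_gmap_inv[h' [hK h'K]] ep eq er].
exists f', h'; split; first by exists f.
- by exists h.
- by move=> a; rewrite -ep f'K.
- by move=> a; rewrite -{2}(f'K a) eq hK.
- by move=> b; rewrite -er h'K.
Qed.

Lemma bispan_iso_trans t s u :
  bispan_iso s t -> bispan_iso t u -> bispan_iso s u.
Proof.
case=> f [h] [bf bh ep eq er] [f'] [h'] [bf' bh' ep' eq' er'].
exists (gcomp f f'), (gcomp h h'); split=> /=.
- exact: (bij_comp bf' bf).
- exact: (bij_comp bh' bh).
- by move=> a; rewrite ep' ep.
- by move=> a; rewrite eq' eq.
- by move=> a; rewrite er' er.
Qed.

Lemma ord_of_iso s : bispan_iso (bispan_of (ord_of s)) s.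
Proof.
exists (of_skel (bA s)), (of_skel (bB s)); split=> //=.
- exact: enum_val_bij.
- exact: enum_val_bij.
- by move=> a; rewrite enum_rankK.
Qed.

Definition ord_iso (x y : ord_bispan X Y) : bool :=
  `[< bispan_iso (bispan_of x) (bispan_of y) >].

Fact ord_iso_refl : reflexive ord_iso.
Proof. by move=> x; apply/asboolP/bispan_iso_refl. Qed.
Fact ord_iso_sym : symmetric ord_iso.
Proof. by move=> x y; apply/asboolP/asboolP=> /bispan_iso_sym. Qed.
Fact ord_iso_trans : transitive ord_iso.
Proof.
move=> y x z /asboolP xy /asboolP yz; apply/asboolP.
exact: bispan_iso_trans xy yz.
Qed.

Canonical ord_iso_equiv := EquivRel ord_iso ord_iso_refl ord_iso_sym ord_iso_trans.

End IsoTheory.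

Definition bispans (G : finGroupType) (X Y : gset G) :=
  {eq_quot (@ord_iso_equiv G X Y)}%qT.

HB.instance Definition _ (G : finGroupType) (X Y : gset G) :=
  Choice.on (bispans X Y).

HB.instance Definition _ (G : finGroupType) (X Y : gset G) :=
  EqQuotient.on (bispans X Y).

Section Classes.
Variables (G : finGroupType) (X Y : gset G).
Implicit Types (s t u v : bispan X Y) (c d : bispans X Y).

Definition bclass s : bispans X Y := (\pi_(bispans X Y) (ord_of s))%qT.
Definition brepr c : bispan X Y := bispan_of (generic_quotient.repr c).

Lemma bclassP s t : bclass s = bclass t <-> bispan_iso s t.
Proof.
split=> [/eqmodP/asboolP st|st].
  apply: bispan_iso_trans (ord_of_iso t).
  exact: bispan_iso_trans (bispan_iso_sym (ord_of_iso s)) st.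
apply/eqmodP/asboolP; apply: bispan_iso_trans (ord_of_iso s) _.
exact: bispan_iso_trans st (bispan_iso_sym (ord_of_iso t)).
Qed.

Lemma bclass_repr c : bclass (brepr c) = c.
Proof.
rewrite -[RHS]reprK; apply/eqmodP/asboolP.
exact: ord_of_iso.
Qed.

Lemma brepr_class s : bispan_iso (brepr (bclass s)) s.
Proof. by apply/bclassP; rewrite bclass_repr. Qed.

Definition bispans_add c d := bclass (bispan_add (brepr c) (brepr d)).
Definition bispans_mul c d := bclass (bispan_mul (brepr c) (brepr d)).

End Classes.

Section SemiringLaws.
Variables (G : finGroupType) (X Y : gset G).
Implicit Types s t u v : bispan X Y.

Lemma gsum_map_bij (A B A' B' : gset G) (f : gmap A A') (h : gmap B B') :
  bijective f -> bijective h ->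
  bijective (gcase (gcomp f (ginl A' B')) (gcomp h (ginr A' B'))).
Proof.
move=> [f' fK f'K] [h' hK h'K].
exists (fun x : A' + B' => match x with inl a => inl (f' a) | inr b => inr (h' b) end).
  by case=> x /=; rewrite ?fK ?hK.
by case=> x /=; rewrite ?f'K ?h'K.
Qed.

Lemma gpair_bij (Z A B A' B' : gset G) (f : gmap A Z) (h : gmap B Z)
    (f' : gmap A' Z) (h' : gmap B' Z) (k : gmap A A') (l : gmap B B')
    (ek : forall a, f' (k a) = f a) (el : forall b, h' (l b) = h b)
    (e : forall x, f' (gcomp (gpull1 f h) k x) = h' (gcomp (gpull2 f h) l x)) :
  bijective k -> bijective l -> bijective (gpair e).
Proof.
move=> [k' kK k'K] [l' lK l'K].
have e' (w : gpull f' h') : f (k' (val w).1) == h (l' (val w).2).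
  by rewrite -ek -el k'K l'K (valP w).
exists (fun w => exist _ (k' (val w).1, l' (val w).2) (e' w)) => -[[a b] E].
  by apply: val_inj; rewrite /= kK lK.
by apply: val_inj; rewrite /= k'K l'K.
Qed.

Lemma bispan_add_iso s s' t t' : bispan_iso s s' -> bispan_iso t t' ->
  bispan_iso (bispan_add s t) (bispan_add s' t').
Proof.
case=> f [h] [bf bh ep eq er] [f'] [h'] [bf' bh' ep' eq' er'].
exists (gcase (gcomp f (ginl _ _)) (gcomp f' (ginr _ _))),
       (gcase (gcomp h (ginl _ _)) (gcomp h' (ginr _ _))).
split; [exact: gsum_map_bij | exact: gsum_map_bij | | | ];
  by case=> x /=; rewrite ?(ep, ep', eq, eq', er, er').
Qed.

Lemma bispan_mul_iso s s' t t' : bispan_iso s s' -> bispan_iso t t' ->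
  bispan_iso (bispan_mul s t) (bispan_mul s' t').
Proof.
case=> f [h] [bf bh ep eq er] [f'] [h'] [bf' bh' ep' eq' er'].
have e1 x : br s' (bq s' (f x)) = br s (bq s x) by rewrite eq er.
have e2 x : br t' (bq t' (f' x)) = br t (bq t x) by rewrite eq' er'.
have E1 (x : bAB s t) : gcomp (bq s') (br s') (gcomp (gpull1 _ _) f x)
    = br t' (gcomp (gpull2 _ _) h' x).
  by rewrite /= e1 er'; apply/eqP/(valP x).
have E2 (x : bAB t s) : gcomp (bq t') (br t') (gcomp (gpull1 _ _) f' x)
    = br s' (gcomp (gpull2 _ _) h x).
  by rewrite /= e2 er; apply/eqP/(valP x).
have E3 (x : gpull (br s) (br t)) : br s' (gcomp (gpull1 _ _) h x)
    = br t' (gcomp (gpull2 _ _) h' x).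
  by rewrite /= er er'; apply/eqP/(valP x).
exists (gcase (gcomp (gpair E1) (ginl _ _)) (gcomp (gpair E2) (ginr _ _))),
       (gpair E3).
split.
- by apply: gsum_map_bij; apply: gpair_bij.
- exact: gpair_bij.
- by case=> x /=; rewrite ?ep ?ep'.
- by case=> x; apply: val_inj; rewrite /= ?eq ?eq'.
- by move=> x /=; rewrite er.
Qed.

Lemma bispan_addA s t u :
  bispan_iso (bispan_add s (bispan_add t u)) (bispan_add (bispan_add s t) u).
Proof.
pose F (A B C : gset G) : gmap (gsum A (gsum B C)) (gsum (gsum A B) C) :=
  gcase (gcomp (ginl _ _) (ginl _ _))
        (gcase (gcomp (ginr _ _) (ginl _ _)) (ginr _ _)).
have bF A B C : bijective (F A B C).
  exists (fun x => match x with
    | inl (inl a) => inl a | inl (inr b) => inr (inl b) | inr c => inr (inr c)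
    end).
  - by move=> [a|[b|c]].
  - by move=> [[a|b]|c].
exists (F _ _ _), (F _ _ _); split; [exact: bF | exact: bF | | | ].
- by move=> [a|[b|c]].
- by move=> [a|[b|c]].
- by move=> [a|[b|c]].
Qed.

Lemma bispan_addC s t : bispan_iso (bispan_add s t) (bispan_add t s).
Proof.
pose F (A B : gset G) : gmap (gsum A B) (gsum B A) :=
  gcase (ginr _ _) (ginl _ _).
have bF A B : bijective (F A B).
  by exists (F B A); case.
by exists (F _ _), (F _ _); split; [exact: bF | exact: bF | case | case | case].
Qed.

Lemma bispan_add0 s : bispan_iso (bispan_add (bispan0 X Y) s) s.
Proof.
pose F (A : gset G) : gmap (gsum (gempty G) A) A :=
  gcase (gfrom_empty _) (gid _).
have bF A : bijective (F A).
  by exists inr => //; case=> // -[].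
by exists (F _), (F _); split; [exact: bF | exact: bF | case=> [[]|] | case=> [[]|] | case=> [[]|]].
Qed.

Lemma bispan_mulC s t : bispan_iso (bispan_mul s t) (bispan_mul t s).
Proof.
pose F (A B : gset G) : gmap (gsum A B) (gsum B A) :=
  gcase (ginr _ _) (ginl _ _).
have E s1 t1 (x : gpull (br s1) (br t1)) :
    br t1 (gpull2 _ _ x) = br s1 (gpull1 _ _ x :> @bB G X Y s1).
  exact/esym/eqP/(valP x).
exists (F _ _), (gpair (@E s t)); split.
- by exists (F _ _); case.
- by exists (gpair (@E t s)) => -[[a b] e]; apply: val_inj.
- by case.
- by case=> x; apply: val_inj.
- by move=> x /=; apply/esym/eqP/(valP x).
Qed.

Lemma bispan_mul1 s : bispan_iso (bispan_mul (bispan1 X Y) s) s.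
Proof.
pose F1 (x : bAB (bispan1 X Y) s) : bA s :=
  match (val x).1 : void with end.
have F1J x g : F1 (gact _ x g) = gact _ (F1 x) g by case: x => -[[]].
have F0 (x : bAB (bispan1 X Y) s) : False by case: x => -[[]].
exists (gcase (GMap F1J) (gpull1 _ _)), (gpull2 _ _).
split.
- have e a : gcomp (bq s) (br s) a == br (bispan1 X Y) (br s (bq s a)) by [].
  exists (fun a => inr (exist _ (a, br s (bq s a)) (e a))) => // -[x|x].
    by case: (F0 x).
  case: x => -[a y] E /=; congr inr; apply: val_inj => /=.
  by congr pair; apply/eqP.
- have e b : br (bispan1 X Y) (br s b) == br s b by [].
  exists (fun b => exist _ (br s b, b) (e b)) => // -[[y b] E].
  by apply: val_inj => /=; congr pair; apply/esym/eqP.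
- by case=> // x; case: (F0 x).
- by case=> // x; case: (F0 x).
- by case=> x /= /eqP.
Qed.

Lemma bispan_mul0 s :
  bispan_iso (bispan_mul (bispan0 X Y) s) (bispan0 X Y).
Proof.
have A0 (x : bA (bispan_mul (bispan0 X Y) s)) : False.
  by case: x => [[[[]]]|[[a []]]].
have B0 (x : bB (bispan_mul (bispan0 X Y) s)) : False.
  by case: x => [[[]]].
pose F (x : bA (bispan_mul (bispan0 X Y) s)) : gempty G :=
  match A0 x with end.
pose H (x : bB (bispan_mul (bispan0 X Y) s)) : gempty G :=
  match B0 x with end.
have FJ x g : F (gact _ x g) = gact _ (F x) g by case: (A0 x).
have HJ x g : H (gact _ x g) = gact _ (H x) g by case: (B0 x).
exists (GMap FJ), (GMap HJ); split.
- by exists (fun x : void => match x with end) => [x|[]]; case: (A0 x).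
- by exists (fun x : void => match x with end) => [x|[]]; case: (B0 x).
- by move=> x; case: (A0 x).
- by move=> x; case: (A0 x).
- by move=> x; case: (B0 x).
Qed.

Lemma bispan_mulDl s t u :
  bispan_iso (bispan_mul (bispan_add s t) u)
             (bispan_add (bispan_mul s u) (bispan_mul t u)).
Proof.
have @F : bA (bispan_mul (bispan_add s t) u) ->
         bA (bispan_add (bispan_mul s u) (bispan_mul t u)).
  move=> [[[[a|a] c] e]|[[c [b|b]] e]].
  - exact: (inl (inl (exist _ (a, c) e))).
  - exact: (inr (inl (exist _ (a, c) e))).
  - exact: (inl (inr (exist _ (c, b) e))).
  - exact: (inr (inr (exist _ (c, b) e))).
have @F' : bA (bispan_add (bispan_mul s u) (bispan_mul t u)) ->
          bA (bispan_mul (bispan_add s t) u).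
  move=> [[[[a c] e]|[[c b] e]]|[[[a c] e]|[[c b] e]]].
  - exact: (inl (exist _ (inl a, c) e)).
  - exact: (inr (exist _ (c, inl b) e)).
  - exact: (inl (exist _ (inr a, c) e)).
  - exact: (inr (exist _ (c, inr b) e)).
have @H : bB (bispan_mul (bispan_add s t) u) ->
         bB (bispan_add (bispan_mul s u) (bispan_mul t u)).
  move=> [[[b|b] c] e].
  - exact: (inl (exist _ (b, c) e)).
  - exact: (inr (exist _ (b, c) e)).
have @H' : bB (bispan_add (bispan_mul s u) (bispan_mul t u)) ->
          bB (bispan_mul (bispan_add s t) u).
  move=> [[[b c] e]|[[b c] e]].
  - exact: (exist _ (inl b, c) e).
  - exact: (exist _ (inr b, c) e).
have FJ x g : F (gact _ x g) = gact _ (F x) g.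
  case: x => [[[[a|a] c] e]|[[c [b|b]] e]].
  - by congr (inl (inl _)); apply: val_inj.
  - by congr (inr (inl _)); apply: val_inj.
  - by congr (inl (inr _)); apply: val_inj.
  - by congr (inr (inr _)); apply: val_inj.
have HJ x g : H (gact _ x g) = gact _ (H x) g.
  case: x => [[[b|b] c] e].
  - by congr inl; apply: val_inj.
  - by congr inr; apply: val_inj.
exists (GMap FJ), (GMap HJ); split.
- exists F'.
  + by move=> [[[[a|a] c] e]|[[c [b|b]] e]].
  + by move=> [[[[a c] e]|[[c b] e]]|[[[a c] e]|[[c b] e]]].
- exists H'.
  + by move=> [[[b|b] c] e].
  + by move=> [[[b c] e]|[[b c] e]].
- by move=> [[[[a|a] c] e]|[[c [b|b]] e]].
- move=> [[[[a|a] c] e]|[[c [b|b]] e]].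
  + by congr inl; apply: val_inj.
  + by congr inr; apply: val_inj.
  + by congr inl; apply: val_inj.
  + by congr inr; apply: val_inj.
- by move=> [[[b|b] c] e].
Qed.

Lemma bispan_mulA s t u :
  bispan_iso (bispan_mul s (bispan_mul t u)) (bispan_mul (bispan_mul s t) u).
Proof.
have tr (x y z : Y) : x == y -> y == z -> x == z by move=> /eqP-> /eqP->.
have sy (x y : Y) : x == y -> y == x by move=> /eqP->.
have @F : bA (bispan_mul s (bispan_mul t u)) ->
         bA (bispan_mul (bispan_mul s t) u).
  move=> [[[a [[b c] e1]] e]|[[[[[b c] e1]|[[c b] e1]] a] e]].
  - exact: (inl (exist _ (inl (exist _ (a, b) e), c) (tr _ _ _ e e1))).
  - exact: (inl (exist _ (inr (exist _ (b, a) e), c) (tr _ _ _ (sy _ _ e) e1))).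
  - exact: (inr (exist _ (c, exist _ (a, b) (sy _ _ e)) (tr _ _ _ e1 e))).
have @F' : bA (bispan_mul (bispan_mul s t) u) ->
         bA (bispan_mul s (bispan_mul t u)).
  move=> [[[[[[a b] e1]|[[b a] e1]] c] e]|[[c [[a b] e1]] e]].
  - exact: (inl (exist _ (a, exist _ (b, c) (tr _ _ _ (sy _ _ e1) e)) e1)).
  - exact: (inr (exist _ (inl (exist _ (b, c) (tr _ _ _ e1 e)), a) e1)).
  - exact: (inr (exist _ (inr (exist _ (c, b) (tr _ _ _ e e1)), a)
                         (sy _ _ e1))).
have @H : bB (bispan_mul s (bispan_mul t u)) ->
          bB (bispan_mul (bispan_mul s t) u).
  move=> [[a [[b c] e1]] e].
  exact: (exist _ (exist _ (a, b) e, c) (tr _ _ _ e e1)).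
have @H' : bB (bispan_mul (bispan_mul s t) u) ->
           bB (bispan_mul s (bispan_mul t u)).
  move=> [[[[a b] e1] c] e].
  exact: (exist _ (a, exist _ (b, c) (tr _ _ _ (sy _ _ e1) e)) e1).
have FJ x g : F (gact _ x g) = gact _ (F x) g.
  case: x => [[[a [[b c] e1]] e]|[[[[[b c] e1]|[[c b] e1]] a] e]].
  - congr inl; apply: val_inj; congr pair; congr inl; exact: val_inj.
  - congr inl; apply: val_inj; congr pair; congr inr; exact: val_inj.
  - congr inr; apply: val_inj; congr pair; exact: val_inj.
have HJ x g : H (gact _ x g) = gact _ (H x) g.
  case: x => [[a [[b c] e1]] e].
  apply: val_inj; congr pair; exact: val_inj.
exists (GMap FJ), (GMap HJ); split.
- exists F'.
  + move=> [[[a [[b c] e1]] e]|[[[[[b c] e1]|[[c b] e1]] a] e]].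
    * congr inl; apply: val_inj; congr pair; exact: val_inj.
    * congr inr; apply: val_inj; congr pair; congr inl; exact: val_inj.
    * congr inr; apply: val_inj; congr pair; congr inr; exact: val_inj.
  + move=> [[[[[[a b] e1]|[[b a] e1]] c] e]|[[c [[a b] e1]] e]].
    * congr inl; apply: val_inj; congr pair; congr inl; exact: val_inj.
    * congr inl; apply: val_inj; congr pair; congr inr; exact: val_inj.
    * congr inr; apply: val_inj; congr pair; exact: val_inj.
- exists H'.
  + move=> [[a [[b c] e1]] e].
    apply: val_inj; congr pair; exact: val_inj.
  + move=> [[[[a b] e1] c] e].
    apply: val_inj; congr pair; exact: val_inj.
- by move=> [[[a [[b c] e1]] e]|[[[[[b c] e1]|[[c b] e1]] a] e]].
- move=> [[[a [[b c] e1]] e]|[[[[[b c] e1]|[[c b] e1]] a] e]].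
  + apply: val_inj; congr pair; exact: val_inj.
  + apply: val_inj; congr pair; exact: val_inj.
  + apply: val_inj; congr pair; exact: val_inj.
- by move=> [[a [[b c] e1]] e].
Qed.

End SemiringLaws.

Section SemiringInstance.
Variables (G : finGroupType) (X Y : gset G).
Implicit Types (s t : bispan X Y) (c d e : bispans X Y).

Lemma bclass_add s t :
  bispans_add (bclass s) (bclass t) = bclass (bispan_add s t).
Proof. by apply/bclassP/bispan_add_iso; apply: brepr_class. Qed.

Lemma bclass_mul s t :
  bispans_mul (bclass s) (bclass t) = bclass (bispan_mul s t).
Proof. by apply/bclassP/bispan_mul_iso; apply: brepr_class. Qed.

Fact bispans_addA : associative (@bispans_add G X Y).
Proof.
move=> c d e; rewrite -(bclass_repr c) -(bclass_repr d) -(bclass_repr e).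
by rewrite !bclass_add; apply/bclassP/bispan_addA.
Qed.
Fact bispans_addC : commutative (@bispans_add G X Y).
Proof.
move=> c d; rewrite -(bclass_repr c) -(bclass_repr d) !bclass_add.
exact/bclassP/bispan_addC.
Qed.
Fact bispans_add0 : left_id (bclass (bispan0 X Y)) (@bispans_add G X Y).
Proof.
by move=> c; rewrite -(bclass_repr c) bclass_add; apply/bclassP/bispan_add0.
Qed.
Fact bispans_mulA : associative (@bispans_mul G X Y).
Proof.
move=> c d e; rewrite -(bclass_repr c) -(bclass_repr d) -(bclass_repr e).
by rewrite !bclass_mul; apply/bclassP/bispan_mulA.
Qed.
Fact bispans_mulC : commutative (@bispans_mul G X Y).
Proof.
move=> c d; rewrite -(bclass_repr c) -(bclass_repr d) !bclass_mul.
exact/bclassP/bispan_mulC.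
Qed.
Fact bispans_mul1 : left_id (bclass (bispan1 X Y)) (@bispans_mul G X Y).
Proof.
by move=> c; rewrite -(bclass_repr c) bclass_mul; apply/bclassP/bispan_mul1.
Qed.
Fact bispans_mul0 : left_zero (bclass (bispan0 X Y)) (@bispans_mul G X Y).
Proof.
by move=> c; rewrite -(bclass_repr c) bclass_mul; apply/bclassP/bispan_mul0.
Qed.
Fact bispans_mulDl :
  left_distributive (@bispans_mul G X Y) (@bispans_add G X Y).
Proof.
move=> c d e; rewrite -(bclass_repr c) -(bclass_repr d) -(bclass_repr e).
by rewrite !(bclass_add, bclass_mul); apply/bclassP/bispan_mulDl.
Qed.

HB.instance Definition _ := GRing.isNmodule.Build (bispans X Y)
  bispans_addA bispans_addC bispans_add0.
HB.instance Definition _ := GRing.Nmodule_isComPzSemiRing.Build (bispans X Y)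
  bispans_mulA bispans_mulC bispans_mul1 bispans_mulDl bispans_mul0.

End SemiringInstance.

(** * Group completion of a commutative semiring *)

Section GroupCompletion.
Variable R : comPzSemiRingType.
Local Open Scope ring_scope.
Implicit Types x y z : R * R.

(** [(a, b)] stands for the formal difference [a - b]. *)
Definition diff_eq x y : bool :=
  `[< exists k : R, x.1 + y.2 + k = y.1 + x.2 + k >].

Fact diff_eq_refl : reflexive diff_eq.
Proof. by move=> x; apply/asboolP; exists 0. Qed.
Fact diff_eq_sym : symmetric diff_eq.
Proof. by move=> x y; apply/asboolP/asboolP=> -[k e]; exists k. Qed.
Fact diff_eq_trans : transitive diff_eq.
Proof.
move=> [c d] [a b] [e f] /asboolP[k /= E1] /asboolP[l /= E2]; apply/asboolP.
exists (c + d + k + l) => /=.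
have -> : a + f + (c + d + k + l) = (a + d + k) + (c + f + l).
  by rewrite !addrA (ACl (1*4*5*3*2*6)).
rewrite E1 E2 !addrA.
by rewrite (ACl (4*2*1*5*3*6)).
Qed.

Canonical diff_equiv := EquivRel diff_eq diff_eq_refl diff_eq_sym diff_eq_trans.

Definition completion := {eq_quot diff_equiv}%qT.
HB.instance Definition _ := Choice.on completion.
HB.instance Definition _ := EqQuotient.on completion.

Definition completion_of (a b : R) : completion := (\pi_completion (a, b))%qT.

Lemma completion_ofP a b c d :
  completion_of a b = completion_of c d <-> exists k, a + d + k = c + b + k.
Proof. by split=> [/eqmodP/asboolP|e]; last exact/eqmodP/asboolP. Qed.

Lemma completion_ofE (v : completion) :
  v = completion_of (generic_quotient.repr v).1 (generic_quotient.repr v).2.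
Proof. by rewrite /completion_of -surjective_pairing reprK. Qed.

Lemma completionW (P : completion -> Prop) :
  (forall a b, P (completion_of a b)) -> forall v, P v.
Proof. by move=> h v; rewrite (completion_ofE v). Qed.

Lemma repr_completion_of a b :
  exists k, (generic_quotient.repr (completion_of a b)).1 + b + k
          = a + (generic_quotient.repr (completion_of a b)).2 + k.
Proof. by apply/completion_ofP; rewrite -completion_ofE. Qed.

Definition completion_add (v w : completion) : completion :=
  let: (a, b) := generic_quotient.repr v in
  let: (c, d) := generic_quotient.repr w in completion_of (a + c) (b + d).

Definition completion_opp (v : completion) : completion :=
  let: (a, b) := generic_quotient.repr v in completion_of b a.

Definition completion_mul (v w : completion) : completion :=
  let: (a, b) := generic_quotient.repr v in
  let: (c, d) := generic_quotient.repr w in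
  completion_of (a * c + b * d) (a * d + b * c).

Lemma completion_addE a b c d :
  completion_add (completion_of a b) (completion_of c d)
  = completion_of (a + c) (b + d).
Proof.
rewrite /completion_add; move: (repr_completion_of a b) (repr_completion_of c d).
case: generic_quotient.repr => a' b' /= [k e].
case: generic_quotient.repr => c' d' /= [l f].
apply/completion_ofP; exists (k + l).
transitivity ((a' + b + k) + (c' + d + l)); first by ring.
by rewrite e f; ring.
Qed.

Lemma completion_oppE a b :
  completion_opp (completion_of a b) = completion_of b a.
Proof.
rewrite /completion_opp; move: (repr_completion_of a b).
case: generic_quotient.repr => a' b' /= [k e].
by apply/completion_ofP; exists k; rewrite [b' + a]addrC [b + a']addrC.
Qed.

Lemma completion_mulE a b c d :
  completion_mul (completion_of a b) (completion_of c d)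
  = completion_of (a * c + b * d) (a * d + b * c).
Proof.
rewrite /completion_mul; move: (repr_completion_of a b) (repr_completion_of c d).
case: generic_quotient.repr => a' b' /= [k e].
case: generic_quotient.repr => c' d' /= [l f].
transitivity (completion_of (a * c' + b * d') (a * d' + b * c')).
  apply/completion_ofP; exists (k * c' + k * d').
  transitivity ((a' + b + k) * c' + (a + b' + k) * d'); first by ring.
  by rewrite e -[X in _ + X * d']e; ring.
apply/completion_ofP; exists (a * l + b * l).
transitivity (a * (c' + d + l) + b * (c + d' + l)); first by ring.
by rewrite f -[X in _ + b * X]f; ring.
Qed.

Fact completion_addA : associative completion_add.
Proof.
elim/completionW=> a b; elim/completionW=> c d; elim/completionW=> e f.
by rewrite !completion_addE !addrA.
Qed.
Fact completion_addC : commutative completion_add.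
Proof.
elim/completionW=> a b; elim/completionW=> c d.
by rewrite !completion_addE [a + c]addrC [b + d]addrC.
Qed.
Fact completion_add0 : left_id (completion_of 0 0) completion_add.
Proof. by elim/completionW=> a b; rewrite completion_addE !add0r. Qed.
Fact completion_addN :
  left_inverse (completion_of 0 0) completion_opp completion_add.
Proof.
elim/completionW=> a b; rewrite completion_oppE completion_addE.
by apply/completion_ofP; exists 0; ring.
Qed.
Fact completion_mulA : associative completion_mul.
Proof.
elim/completionW=> a b; elim/completionW=> c d; elim/completionW=> e f.
by rewrite !completion_mulE; congr completion_of; ring.
Qed.
Fact completion_mulC : commutative completion_mul.
Proof.
elim/completionW=> a b; elim/completionW=> c d.
by rewrite !completion_mulE; congr completion_of; ring.
Qed.
Fact completion_mul1 : left_id (completion_of 1 0) completion_mul.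
Proof.
by elim/completionW=> a b; rewrite completion_mulE; congr completion_of; ring.
Qed.
Fact completion_mulDl : left_distributive completion_mul completion_add.
Proof.
elim/completionW=> a b; elim/completionW=> c d; elim/completionW=> e f.
rewrite !(completion_mulE, completion_addE).
by congr completion_of; ring.
Qed.

HB.instance Definition _ := GRing.isZmodule.Build completion
  completion_addA completion_addC completion_add0 completion_addN.
HB.instance Definition _ := GRing.Zmodule_isComPzRing.Build completion
  completion_mulA completion_mulC completion_mul1 completion_mulDl.

End GroupCompletion.

(** * Tambara finiteness *)

Definition free_tambara (G : finGroupType) (X Y : gset G) : comPzRingType :=
  completion (bispans X Y).

(** The Z-subalgebras of a commutative ring are its subrings. *)
Definition fingen_Zalgebra (A : comPzRingType) : Prop :=
  exists s : seq A, forall S : {pred A},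
    GRing.subring_closed S -> {subset s <= S} -> forall x, x \in S.

Definition tambara_finite (G : finGroupType) : Prop :=
  forall (X : gset G) (L : {group G}),
    fingen_Zalgebra (free_tambara X (gcosets L)).

Definition dedekind (G : finGroupType) : Prop :=
  forall H : {group G}, (H <| [set: G])%g.

(* Main.v *)
From mathcomp Require Import all_boot all_fingroup all_algebra.
From mathcomp Require Import boolp ring.
Require Import Defs.

Set Implicit Arguments.
Unset Strict Implicit.
Unset Printing Implicit Defensive.

Import GRing.Theory.

(** The proof works for every target G-set Y, not only for orbits G/L.

    Cutting the middle object B of a bispan into orbits writes its class as a
    sum of classes with B transitive.  Up to isomorphism there are finitely
    many transitive B with a map r : B -> Y, so one r may be fixed.  The class
    of [X <- A -> B -> Y] is then the transfer along r of the bispan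
    [X <- A -> B = B], called a monomial because disjoint union of the A's is
    multiplication in the semiring P(X, B) ([monomialM]).  Cutting A into
    orbits factors every monomial over B as a product of powers of finitely
    many monomials x_1, ..., x_N ([orbit_representatives],
    [monomial_factors]).  It remains to bound the exponents that are needed.

    In a Dedekind group all points of B have the same stabilizer, so the
    automorphisms of B over Y act simply transitively on each fibre of r
    ([dedekind_deck]): r is a Galois covering.  Let n be the size of a fibre
    and let y_u be the n conjugates of x = x_k under these automorphisms, x
    itself being one of them.  Then x is a root of the monic polynomial
    prod_u (t - y_u).  Its coefficients, up to sign, are the elementary
    symmetric functions of the y_u, and these are restrictions along r of
    explicit classes e_i in P(X, Y) ([elementary], [restrict_elementary]): the
    middle object of e_i consists of the i-element subsets of the fibres of r.
    By Frobenius reciprocity ([frobenius]) multiplying by e_i commutes with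
    the transfer, so the polynomial identity, multiplied by any z in P(X, B)
    and transferred ([vieta_relation]), reads

      tr(x^n z) = e_1 tr(x^(n-1) z) - e_2 tr(x^(n-2) z) + ... .

    Hence the e_i of the x_k, together with the finitely many transfers of
    monomials whose exponents are all smaller than n, generate everything
    over this r ([monomials_in_subring], [transfers_finite]). *)

(** * Integral relations pushed along an additive map *)

Section Algebra.
Local Open Scope ring_scope.
Variables (R : comPzSemiRingType) (A : comPzRingType) (f : R -> A).

(** The expansion of prod_u (y_one - y_u) = 0.  The semiring R has no signs, so
    they are inserted after applying f.  The terms of U and of [one |: U], for
    U not containing [one], are f of the same element with opposite signs. *)
Lemma alternating_sum_root (D : finType) (one : D) (y : D -> R) (z : R) :
  \sum_(U : {set D})
    (-1) ^+ #|U| * f (\prod_(u in U) y u * (y one ^+ (#|D| - #|U|) * z)) = 0.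
Proof.
rewrite (bigID (fun U : {set D} => one \in U)) /=.
rewrite (reindex_onto (fun U => one |: U) (fun U => U :\ one)) /=; last first.
  by move=> U; apply: setD1K.
rewrite (eq_bigl (fun U : {set D} => one \notin U)); last first.
  move=> U; rewrite setU11 /=; apply/eqP/idP => [<-|/setU1K //].
  by rewrite !inE eqxx.
rewrite -big_split big1 //= => U oneU.
have ltU : (#|U| < #|D|)%N.
  by rewrite -cardsT; apply: proper_card; rewrite properT; apply: contraNneq oneU => ->.
rewrite big_setU1 //= cardsU1 oneU /= add1n subnS exprS.
move: ltU; rewrite -subn_gt0; case: (#|D| - #|U|)%N => //= k _; rewrite exprS.
set P := \prod_(u in U) _; set E := y one ^+ _.
have -> : y one * P * (E * z) = P * (y one * E * z) by ring.
by rewrite mulN1r mulNr addNr.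
Qed.

(** The previous identity sorted by the size of U: multiplication by the i-th
    elementary symmetric function becomes, after f, multiplication by [e i]. *)
Lemma vieta_relation (D : finType) (one : D) (y : D -> R) (e : nat -> A) :
  (forall i w, \sum_(U : {set D} | #|U| == i) f (\prod_(u in U) y u * w)
     = e i * f w) ->
  forall z, f (y one ^+ #|D| * z)
    = - \sum_(i < #|D|) (-1) ^+ i.+1 * (e i.+1 * f (y one ^+ (#|D| - i.+1) * z)).
Proof.
move=> eE z; apply/eqP; rewrite -addr_eq0; apply/eqP.
rewrite -[RHS](alternating_sum_root one y z).
rewrite [RHS](partition_big (fun U : {set D} => inord #|U| : 'I_#|D|.+1) predT) //=.
have cardE (i : 'I_#|D|.+1) (U : {set D}) : (inord #|U| == i) = (#|U| == i :> nat).
  by rewrite -val_eqE /= inordK // ltnS max_card.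
have termE (i : 'I_#|D|.+1) : \sum_(U : {set D} | inord #|U| == i)
    (-1) ^+ #|U| * f (\prod_(u in U) y u * (y one ^+ (#|D| - #|U|) * z))
  = (-1) ^+ i * \sum_(U : {set D} | #|U| == i)
       f (\prod_(u in U) y u * (y one ^+ (#|D| - i) * z)).
  rewrite mulr_sumr; apply: eq_big => [U|U]; first exact: cardE.
  by rewrite cardE => /eqP ->.
rewrite (eq_bigr _ (fun i _ => termE i)) big_ord_recl /= expr0 mul1r.
rewrite (big_pred1 set0) => [|U]; last by rewrite cards_eq0.
rewrite big_set0 mul1r subn0; congr (_ + _).
by apply: eq_bigr => i _; rewrite eE.
Qed.

(** Each use of the monic relation of degree n lowers the total degree of a
    monomial having some exponent at least n, so induction on the total degree
    reduces to exponents below n. *)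
Lemma monomials_in_subring (K : finType) (x : K -> R) (n : nat)
    (e : K -> nat -> A) (S : {pred A}) :
  GRing.subring_closed S ->
  (forall k (i : 'I_n), e k i.+1 \in S) ->
  (forall k z, f (x k ^+ n * z)
     = - \sum_(i < n) (-1) ^+ i.+1 * (e k i.+1 * f (x k ^+ (n - i.+1) * z))) ->
  (forall m : {ffun K -> 'I_n}, f (\prod_k x k ^+ m k) \in S) ->
  forall m : K -> nat, f (\prod_k x k ^+ m k) \in S.
Proof.
move=> Sring eS rel small m.
have [S1 _ SM] := Sring.
have [S0 SD] := GRing.zmod_closedD (GRing.subring_closedB Sring).
have SN := GRing.zmod_closedN (GRing.subring_closedB Sring).
have [d] := ubnP (\sum_k m k); elim: d m => // d IH m /ltnSE led.
have [/forallP lem|/forallPn[k]] := boolP [forall k, m k < n]%N.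
  have := small [ffun k => Ordinal (lem k)].
  by rewrite (eq_bigr _ (fun k _ => congr1 (fun i => x k ^+ nat_of_ord i) (ffunE _ _))).
rewrite -leqNgt => len.
pose m' i k' := if k' == k then (m k - i.+1)%N else m k'.
have mE i : \prod_k' x k' ^+ m' i k'
    = x k ^+ (m k - i.+1) * \prod_(k' | k' != k) x k' ^+ m k'.
  rewrite (bigD1 k) //= /m' eqxx; congr (_ * _).
  by apply: eq_bigr => k' /negbTE ->.
(* the factor x_k^n is traded for lower powers of x_k, the rest being z *)
rewrite (bigD1 k) //= -[X in x k ^+ X](subnKC len) exprD -mulrA rel.
apply: (SN); apply: (big_ind (fun a => a \in S)) => // i _.
apply: (SM); first by rewrite -signr_odd; case: odd; rewrite ?expr1 ?expr0 //; apply: (SN).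
apply: (SM); first exact: eS.
rewrite mulrA -exprD.
have -> : (n - i.+1 + (m k - n) = m k - i.+1)%N.
  by rewrite addnC addnBA // subnK.
rewrite -mE; apply: IH; apply: leq_trans led.
rewrite (bigD1 k) //= [X in (_ < X)%N](bigD1 k) //=.
rewrite (eq_bigr m) => [|k' /negbTE]; last by rewrite /m' => ->.
rewrite ltn_add2r /m' eqxx ltn_subrL /=; exact: leq_ltn_trans (leq0n i) (leq_trans (ltn_ord i) len).
Qed.

End Algebra.

(** * Constructions on finite G-sets *)

Section Constructions.
Variable G : finGroupType.
Implicit Types A B X Y : gset G.

Lemma inj_surj_bij (A B : finType) (f : A -> B) :
  injective f -> (forall b, exists a, f a = b) -> bijective f.
Proof.
move=> f_inj /fin_all_exists[h hK].
by exists h => // a; apply: f_inj; rewrite hK.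
Qed.

Definition gstable A (P : pred A) : Prop := forall a g, P (gact A a g) = P a.

Lemma gstableW (A : gset G) (P : pred A) :
  (forall a g, P a -> P (gact A a g)) -> gstable P.
Proof.
move=> HP a g; apply/idP/idP; last exact: HP.
by move/HP => /(_ g^-1%g); rewrite actK.
Qed.

Lemma gstable_preim A B (f : gmap A B) (P : pred B) :
  gstable P -> gstable (P \o f).
Proof. by move=> HP a g; rewrite /= gfunJ HP. Qed.

Section Sub.
Variables (A : gset G) (P : pred A) (HP : gstable P).

Fact gsub_act_subproof (u : {a | P a}) g : P (gact A (val u) g).
Proof. by rewrite HP (valP u). Qed.
Definition gsub_act (u : {a | P a}) (g : G) : {a | P a} :=
  exist _ (gact A (val u) g) (gsub_act_subproof u g).
Fact gsub_act1 : gsub_act^~ 1%g =1 id.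
Proof. by move=> u; apply: val_inj; rewrite /= act1. Qed.
Fact gsub_actM : forall u, act_morph gsub_act u.
Proof. by move=> u g h; apply: val_inj; rewrite /= actM. Qed.
Definition gsub : gset G := GSet (TotalAction gsub_act1 gsub_actM).

Definition gincl : gmap gsub A := @GMap G gsub A val (fun _ _ => erefl).

End Sub.

Section SubMaps.
Variables (A B : gset G).

Definition gsub_map (f : gmap A B) (P : pred B) (HP : gstable P) :
    gmap (gsub (gstable_preim f HP)) (gsub HP).
Proof.
exists (fun u => exist _ (f (val u)) (valP u)) => u g.
by apply: val_inj; rewrite /= gfunJ.
Defined.

Definition gsub_widen (P P' : pred A) (HP : gstable P) (HP' : gstable P')
    (sPP' : forall a, P a -> P' a) : gmap (gsub HP) (gsub HP').
Proof.
exists (fun u => exist _ (val u) (sPP' _ (valP u))) => u g.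
exact: val_inj.
Defined.

Lemma gsub_split_bij (P P1 P2 : pred A)
    (HP : gstable P) (HP1 : gstable P1) (HP2 : gstable P2)
    (s1 : forall a, P1 a -> P a) (s2 : forall a, P2 a -> P a) :
  (forall a, P a -> P1 a || P2 a) -> (forall a, P1 a -> ~~ P2 a) ->
  bijective (gcase (gsub_widen HP1 HP s1) (gsub_widen HP2 HP s2)).
Proof.
move=> cov dis; apply: inj_surj_bij.
  move=> [[a Pa]|[a Pa]] [[b Pb]|[b Pb]] //= /(congr1 val) /= eab.
  - by congr inl; apply: val_inj.
  - by case/negP: (dis _ Pa); rewrite [a]eab.
  - by case/negP: (dis _ Pb); rewrite -[b]eab.
  - by congr inr; apply: val_inj.
move=> [a Pa]; case/orP: (cov _ Pa) => Pa'.
  by exists (inl (exist _ a Pa')); apply: val_inj.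
by exists (inr (exist _ a Pa')); apply: val_inj.
Qed.

Fact gprod_act1 : (fun (u : A * B) g => (gact A u.1 g, gact B u.2 g))^~ 1%g =1 id.
Proof. by move=> [a b]; rewrite /= !act1. Qed.
Fact gprod_actM :
  forall u, act_morph (fun (u : A * B) g => (gact A u.1 g, gact B u.2 g)) u.
Proof. by move=> [a b] g h; rewrite /= !actM. Qed.
Definition gprod : gset G := GSet (TotalAction gprod_act1 gprod_actM).

Definition gfst : gmap gprod A := @GMap G gprod A fst (fun _ _ => erefl).
Definition gsnd : gmap gprod B := @GMap G gprod B snd (fun _ _ => erefl).

End SubMaps.

Definition gpowerset A : gset G := GSet ((gact A)^*)%act.

Fact gtriv_act1 (D : finType) : (fun (u : D) (g : G) => u)^~ 1%g =1 id.
Proof. by []. Qed.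
Fact gtriv_actM (D : finType) : forall u, act_morph (fun (u : D) (g : G) => u) u.
Proof. by []. Qed.
Definition gtriv (D : finType) : gset G :=
  GSet (TotalAction (@gtriv_act1 D) (@gtriv_actM D)).

(** ** Orbits *)

Definition transitive_from A (a0 : A) : Prop :=
  forall a, exists g, a = gact A a0 g.

Definition stab A (a0 : A) : {set G} := 'C[a0 | gact A]%g.

Lemma stabP A (a : A) g : reflect (gact A a g = a) (g \in stab a).
Proof. exact: astab1P. Qed.

(** The universal property of an orbit: b0 may be any point fixed by the
    stabilizer of a0. *)
Lemma orbit_gmap A B (a0 : A) (b0 : B) :
  transitive_from a0 -> stab a0 \subset stab b0 ->
  exists f : gmap A B, f a0 = b0.
Proof.
move=> tr /subsetP sab.
have [h hE] := fin_all_exists tr.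
have key g g' : gact A a0 g = gact A a0 g' -> gact B b0 g = gact B b0 g'.
  move=> e; have : (g * g'^-1)%g \in stab b0.
    by apply: sab; apply/stabP; rewrite actM e actK.
  by move/stabP; rewrite actM => /(canRL (actKV _ _)).
have fJ a g : gact B b0 (h (gact A a g)) = gact B (gact B b0 (h a)) g.
  by rewrite -actM; apply: key; rewrite -hE actM -hE.
exists (GMap fJ) => /=.
by rewrite -[RHS](act1 (gact B)); apply: key; rewrite -hE act1.
Qed.

Lemma gmap_eq_transitive A B (a0 : A) (f h : gmap A B) :
  transitive_from a0 -> f a0 = h a0 -> f =1 h.
Proof. by move=> tr e a; have [g ->] := tr a; rewrite !gfunJ e. Qed.

Lemma orbit_gmap_bij A B (a0 : A) (b0 : B) :
  transitive_from a0 -> transitive_from b0 -> stab a0 = stab b0 ->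
  exists f : gmap A B, bijective f /\ f a0 = b0.
Proof.
move=> trA trB e.
have /(orbit_gmap trA)[f fE] : stab a0 \subset stab b0 by rewrite e.
have /(orbit_gmap trB)[h hE] : stab b0 \subset stab a0 by rewrite e.
exists f; split=> //; exists h.
  by apply: (@gmap_eq_transitive _ _ _ (gcomp f h) (gid A) trA); rewrite /= fE hE.
by apply: (@gmap_eq_transitive _ _ _ (gcomp h f) (gid B) trB); rewrite /= hE fE.
Qed.

Definition in_orbit A (a0 : A) : pred A := fun a => a \in orbit (gact A) [set: G] a0.

Lemma in_orbitP A (a0 a : A) : reflect (exists g, a = gact A a0 g) (in_orbit a0 a).
Proof.
apply: (iffP orbitP) => [[g _ <-]|[g ->]]; first by exists g.
by exists g.
Qed.

Lemma in_orbit_stable A (a0 : A) : gstable (in_orbit a0).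
Proof.
move=> a g; apply/in_orbitP/in_orbitP => -[h E].
  by exists (h * g^-1)%g; rewrite actM -E actK.
by exists (h * g)%g; rewrite actM -E.
Qed.

Lemma off_orbit_stable A (a0 : A) : gstable (predC (in_orbit a0)).
Proof. by move=> a g; rewrite /= in_orbit_stable. Qed.

Definition orbit_part A (a0 : A) : gset G := gsub (@in_orbit_stable A a0).

Lemma in_orbit_refl A (a0 : A) : in_orbit a0 a0.
Proof. by apply/in_orbitP; exists 1%g; rewrite act1. Qed.

Definition orbit_point A (a0 : A) : orbit_part a0 :=
  exist _ a0 (in_orbit_refl a0).

Lemma orbit_transitive A (a0 : A) : transitive_from (orbit_point a0).
Proof.
by move=> [a aO]; have /in_orbitP[g E] := aO; exists g; apply: val_inj.
Qed.

Lemma card_off_orbit A (a0 : A) : #|gsub (@off_orbit_stable A a0)| < #|A|.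
Proof.
rewrite card_sig; apply: proper_card; apply/properP; split; first exact/subsetP.
by exists a0 => //; rewrite !inE in_orbit_refl.
Qed.

Lemma gstable_true A : gstable (fun _ : A => true).
Proof. by []. Qed.

Lemma gstable_fibre A (I : eqType) (c : A -> I) (S : seq I) :
  (forall a g, c (gact A a g) = c a) -> gstable (fun a => c a \in S).
Proof. by move=> cJ a g; rewrite cJ. Qed.

End Constructions.

(** * Decomposing bispans *)

Section Decompositions.
Local Open Scope ring_scope.
Variable G : finGroupType.
Implicit Types A B X Y Q : gset G.

Lemma bclassD X Y (s t : bispan X Y) :
  bclass s + bclass t = bclass (bispan_add s t).
Proof. exact: bclass_add. Qed.

Lemma bclassM X Y (s t : bispan X Y) :
  bclass s * bclass t = bclass (bispan_mul s t).
Proof. exact: bclass_mul. Qed.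

Definition bsub X Y (t : bispan X Y) (P : pred (bB t)) (HP : gstable P) :
    bispan X Y :=
  Bispan (gcomp (gincl (gstable_preim (bq t) HP)) (bp t)) (gsub_map (bq t) HP)
    (gcomp (gincl HP) (br t)).

Lemma bsub_split X Y (t : bispan X Y) (P P1 P2 : pred (bB t))
    (HP : gstable P) (HP1 : gstable P1) (HP2 : gstable P2) :
  (forall b, P b = P1 b || P2 b) -> (forall b, P1 b -> ~~ P2 b) ->
  bclass (bsub HP) = bclass (bsub HP1) + bclass (bsub HP2).
Proof.
move=> PE dis; rewrite bclassD; apply/esym/bclassP.
have s1 b : P1 b -> P b by rewrite PE => ->.
have s2 b : P2 b -> P b by rewrite PE orbC => ->.
exists (gcase (gsub_widen (gstable_preim (bq t) HP1) (gstable_preim (bq t) HP)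
                 (fun a => s1 (bq t a)))
              (gsub_widen (gstable_preim (bq t) HP2) (gstable_preim (bq t) HP)
                 (fun a => s2 (bq t a)))),
       (gcase (gsub_widen HP1 HP s1) (gsub_widen HP2 HP s2)).
split.
- apply: gsub_split_bij => a; last exact: dis.
  by rewrite /= PE.
- by apply: gsub_split_bij => a; [rewrite PE | exact: dis].
- by case.
- by case=> a; apply: val_inj.
- by case.
Qed.

Lemma bsub_true X Y (t : bispan X Y) (P : pred (bB t)) (HP : gstable P) :
  (forall b, P b) -> bclass (bsub HP) = bclass t.
Proof.
move=> PT; apply/bclassP.
exists (gincl _), (gincl _); split=> //; apply: inj_surj_bij; try exact: val_inj.
  by move=> a; exists (exist _ a (PT (bq t a))).
by move=> b; exists (exist _ b (PT b)).
Qed.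

Lemma bclass_empty X Y (t : bispan X Y) : (bB t -> False) -> bclass t = 0.
Proof.
move=> B0; apply/bclassP.
have A0 (a : bA t) : False := B0 (bq t a).
have FJ (a : bA t) g : (match A0 (gact _ a g) with end : gempty G)
    = gact (gempty G) (match A0 a with end) g by case: (A0 a).
have HJ (b : bB t) g : (match B0 (gact _ b g) with end : gempty G)
    = gact (gempty G) (match B0 b with end) g by case: (B0 b).
exists (GMap FJ), (GMap HJ).
split.
- by exists (fun v : void => match v with end) => [a|[]]; case: (A0 a).
- by exists (fun v : void => match v with end) => [b|[]]; case: (B0 b).
- by move=> a; case: (A0 a).
- by move=> a; case: (A0 a).
- by move=> b; case: (B0 b).
Qed.

(** Summation over the values of an invariant colouring of the middle object;
    the colours carry no action. *)
Lemma bclass_fibres X Y (t : bispan X Y) (I : finType) (c : bB t -> I)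
    (cJ : forall b g, c (gact (bB t) b g) = c b)
    (Hc : forall i, gstable (fun b => c b == i)) :
  bclass t = \sum_i bclass (bsub (Hc i)).
Proof.
suff main (S : seq I) : uniq S ->
    bclass (bsub (gstable_fibre S cJ)) = \sum_(i <- S) bclass (bsub (Hc i)).
  rewrite -big_enum -(main _ (enum_uniq _)) bsub_true // => b.
  exact: mem_enum.
elim: S => [_|i S IH /= /andP[iS uS]].
  by rewrite big_nil bclass_empty // => -[].
rewrite big_cons -IH //; apply: bsub_split => b; first by rewrite inE.
by move=> /eqP ->.
Qed.

(** ** Monomials *)

(** The class of [X <- Q -> B = B]: the function b |-> (product over the fibre
    of Q at b), a product of variables indexed by X. *)
Definition monomial X B Q (p : gmap Q X) (q : gmap Q B) : bispans X B :=
  bclass (Bispan p q (gid B)).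

Lemma bclass_monomial X B (t : bispan X B) :
  bijective (br t) -> bclass t = monomial (bp t) (gcomp (bq t) (br t)).
Proof.
by move=> bij; apply/bclassP; exists (gid _), (br t); split=> //; exists id.
Qed.

Lemma monomial_iso X B Q Q' (p : gmap Q X) (q : gmap Q B) (p' : gmap Q' X)
    (q' : gmap Q' B) (f : gmap Q Q') :
  bijective f -> p' \o f =1 p -> q' \o f =1 q ->
  monomial p q = monomial p' q'.
Proof.
move=> bf ep eq; apply/bclassP; exists f, (gid B); split=> //.
by exists id.
Qed.

Lemma monomial_empty X B Q (p : gmap Q X) (q : gmap Q B) :
  (Q -> False) -> monomial p q = 1.
Proof.
move=> Q0; apply/bclassP.
have FJ (a : Q) g : (match Q0 (gact _ a g) with end : gempty G)
    = gact (gempty G) (match Q0 a with end) g by case: (Q0 a).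
exists (GMap FJ), (gid B); split.
- by exists (fun v : void => match v with end) => [a|[]]; case: (Q0 a).
- by exists id.
- by move=> a; case: (Q0 a).
- by move=> a; case: (Q0 a).
- by [].
Qed.

(** The middle object of the product is the diagonal of B, because both target
    legs are identities, so fibrewise the two products of variables are just
    put side by side. *)
Lemma monomialM X B Q Q' (p : gmap Q X) (q : gmap Q B) (p' : gmap Q' X)
    (q' : gmap Q' B) :
  monomial p q * monomial p' q' = monomial (gcase p p') (gcase q q').
Proof.
rewrite bclassM; apply/bclassP.
exists (gcase (gcomp (gpull1 _ _) (ginl _ _)) (gcomp (gpull1 _ _) (ginr _ _))),
       (gpull1 _ _); split=> /=.
- apply: inj_surj_bij.
    move=> [[[a b] /= e]|[[a b] /= e]] [[[a' b'] /= e']|[[a' b'] /= e']] //= [ea];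
      [congr inl|congr inr]; apply: val_inj => /=; congr pair => //;
      by rewrite -(eqP e) -(eqP e') ea.
  move=> [a|a].
    by exists (inl (exist _ (a, q a) (eqxx _))).
  by exists (inr (exist _ (a, q' a) (eqxx _))).
- apply: inj_surj_bij => [[[b b'] /= e] [[c c'] /= e'] /= ebc|b].
    by apply: val_inj => /=; congr pair => //; rewrite -(eqP e) -(eqP e').
  by exists (exist _ (b, b) (eqxx _)).
- by case.
- by case=> -[[a b] /= e]; last exact/eqP.
- by [].
Qed.

Lemma monomial_split X B Q (p : gmap Q X) (q : gmap Q B) (P P1 P2 : pred Q)
    (HP : gstable P) (HP1 : gstable P1) (HP2 : gstable P2) :
  (forall a, P a = P1 a || P2 a) -> (forall a, P1 a -> ~~ P2 a) ->
  monomial (gcomp (gincl HP) p) (gcomp (gincl HP) q)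
  = monomial (gcomp (gincl HP1) p) (gcomp (gincl HP1) q)
    * monomial (gcomp (gincl HP2) p) (gcomp (gincl HP2) q).
Proof.
move=> PE dis; rewrite monomialM; apply/esym.
have s1 a : P1 a -> P a by rewrite PE => ->.
have s2 a : P2 a -> P a by rewrite PE orbC => ->.
apply: (@monomial_iso _ _ _ _ _ _ _ _
  (gcase (gsub_widen HP1 HP s1) (gsub_widen HP2 HP s2))); try by case.
by apply: gsub_split_bij => a; [rewrite PE | exact: dis].
Qed.

Lemma monomial_true X B Q (p : gmap Q X) (q : gmap Q B) (P : pred Q)
    (HP : gstable P) :
  (forall a, P a) ->
  monomial (gcomp (gincl HP) p) (gcomp (gincl HP) q) = monomial p q.
Proof.
move=> PT; apply: (@monomial_iso _ _ _ _ _ _ _ _ (gincl HP)) => //.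
by apply: inj_surj_bij => [|a]; [exact: val_inj | exists (exist _ a (PT a))].
Qed.

(** ** Transfer and restriction *)

Section Transfer.
Variables (X B Y : gset G) (r : gmap B Y).

Definition btransfer (s : bispan X B) : bispan X Y :=
  Bispan (bp s) (bq s) (gcomp (br s) r).

(** The covariant action of r on classes; [brestrict] is the contravariant one. *)
Definition transfer (c : bispans X B) : bispans X Y :=
  bclass (btransfer (brepr c)).

Lemma transfer_class s : transfer (bclass s) = bclass (btransfer s).
Proof.
apply/bclassP; have [f [h [bf bh ep eq er]]] := brepr_class s.
by exists f, h; split=> // b; rewrite /= er.
Qed.

Lemma transferD : {morph transfer : c d / c + d}.
Proof.
move=> c d; rewrite -(bclass_repr c) -(bclass_repr d) bclassD.
rewrite !transfer_class bclassD; apply/bclassP.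
exists (gid _), (gid _); split=> //; try by exists id.
by case.
Qed.

Lemma transfer0 : transfer 0 = 0.
Proof. by rewrite [LHS]transfer_class; apply: bclass_empty => -[]. Qed.

Definition brestrict (s : bispan X Y) : bispan X B :=
  @Bispan G X B (gpull (gcomp (bq s) (br s)) r) (gpull (br s) r)
    (gcomp (gpull1 _ _) (bp s))
    (gpair (k := gcomp (gpull1 (gcomp (bq s) (br s)) r) (bq s)) (l := gpull2 _ _)
       (fun u => eqP (valP u)))
    (gpull2 _ _).

(** Frobenius reciprocity.  Both sides have middle object B_s x_Y B_t; on the
    right it appears as (B_s x_Y B) x_B B_t. *)
Lemma frobenius s c :
  bclass s * transfer c = transfer (bclass (brestrict s) * c).
Proof.
rewrite -(bclass_repr c); move: (brepr c) => {c} t.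
rewrite bclassM !transfer_class bclassM; apply/bclassP.
have sy (D : eqType) (x y : D) : x == y -> y == x by rewrite eq_sym.
have @F : bA (bispan_mul s (btransfer t)) ->
          bA (btransfer (bispan_mul (brestrict s) t)).
  move=> [[[a b] e]|[[a b] e]].
    exact: (inl (exist _ (exist _ (a, br t b) e, b) (eqxx _))).
  exact: (inr (exist _ (a, exist _ (b, br t (bq t a)) (sy _ _ _ e)) (eqxx _))).
have @H : bB (bispan_mul s (btransfer t)) ->
          bB (btransfer (bispan_mul (brestrict s) t)).
  move=> [[b b'] e].
  exact: (exist _ (exist _ (b, br t b') e, b') (eqxx _)).
have FJ x g : F (gact _ x g) = gact _ (F x) g.
  case: x => [[[a b] e]|[[a b] e]].
    congr inl; apply: val_inj; congr pair; apply: val_inj.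
    by congr pair; rewrite gfunJ.
  congr inr; apply: val_inj; congr pair; apply: val_inj.
  by congr pair; rewrite /= !gfunJ.
have HJ x g : H (gact _ x g) = gact _ (H x) g.
  case: x => [[b b'] e].
  apply: val_inj; congr pair; apply: val_inj.
  by congr pair; rewrite gfunJ.
exists (GMap FJ), (GMap HJ); split.
- apply: inj_surj_bij.
    by move=> [[[a b] e]|[[a b] e]] [[[a' b'] e']|[[a' b'] e']] //= [];
      [move=> e1 _ e2; congr inl|move=> e1 e2 _; congr inr];
      by apply: val_inj; rewrite /= e1 e2.
  move=> [[[[[a b] /= e] b'] /= e']|[[a [[b b'] /= e]] /= e']].
    have E : gcomp (bq s) (br s) a == br (btransfer t) b' by rewrite /= -(eqP e').
    exists (inl (exist _ (a, b') E)); congr inl; apply: val_inj; congr pair.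
    by apply: val_inj; congr pair; rewrite -(eqP e').
  have E : gcomp (bq (btransfer t)) (br (btransfer t)) a == br s b.
    by rewrite /= (eqP e') (eqP e).
  exists (inr (exist _ (a, b) E)); congr inr; apply: val_inj; congr pair.
  by apply: val_inj; congr pair; rewrite -(eqP e').
- apply: inj_surj_bij.
    by move=> [[b b'] e] [[c c'] e'] [e1 _ e2]; apply: val_inj; rewrite /= e1 e2.
  move=> [[[[b b'] /= e] c] /= e'].
  have E : br s b == br (btransfer t) c by rewrite /= -(eqP e').
  exists (exist _ (b, c) E); apply: val_inj; congr pair.
  by apply: val_inj; congr pair; rewrite -(eqP e').
- by move=> [[[a b] e]|[[a b] e]].
- move=> [[[a b] e]|[[a b] e]]; apply: val_inj; congr pair; exact: val_inj.
- by move=> [[b b'] e]; apply/esym/eqP/e.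
Qed.

End Transfer.

End Decompositions.

(** * Galois coverings of G-sets *)

Section Decks.
Variable G : finGroupType.

(** A family of automorphisms of B over Y that is simply transitive on every
    fibre: r is a Galois covering.  The indices form a plain finite set, so that
    the points of one fibre can serve as indices. *)
Record deck (B Y : gset G) (r : gmap B Y) := Deck {
  deck_index :> finType;
  deck_one : deck_index;
  deck_map : deck_index -> gmap B B;
  deck_inv : deck_index -> gmap B B;
  deck_mapK : forall u, cancel (deck_map u) (deck_inv u);
  deck_invK : forall u, cancel (deck_inv u) (deck_map u);
  deck_over : forall u b, r (deck_map u b) = r b;
  deck_reach : forall b b', r b = r b' -> exists u, deck_map u b = b';
  deck_free : forall u v b, deck_map u b = deck_map v b -> u = v;
  deck_inv_one : deck_inv deck_one =1 id
}.

(** As r is equivariant and every point of the transitive set B has the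
    stabilizer of b0, there is for each u in the fibre of b0 a unique
    automorphism sending b0 to u.  It preserves r because it does so at b0, and
    translation by G carries simple transitivity from that fibre to the
    others. *)
Lemma dedekind_deck (dedG : dedekind G) (B Y : gset G) (r : gmap B Y) (b0 : B) :
  transitive_from b0 -> inhabited (deck r).
Proof.
move=> tr; pose D : finType := {b : B | r b == r b0}.
(* normality enters here: stabilizers in one orbit are conjugate *)
have stabE (b : B) : stab b = stab b0.
  have [h ->] := tr b; rewrite /stab astab1_act.
  have /andP[_ /subsetP nH] := dedG [group of 'C[b0 | gact B]%g].
  exact: (normP (nH h (in_setT h))).
have trb (b : B) : transitive_from b.
  move=> b'; have [h ->] := tr b; have [h' ->] := tr b'.
  by exists (h^-1 * h')%g; rewrite actM actK.
have tauP (u : D) : exists t : gmap B B * gmap B B,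
    [/\ cancel t.1 t.2, cancel t.2 t.1 & t.1 b0 = val u].
  have [f [bf fE]] := @orbit_gmap_bij _ _ _ b0 (val u) tr (trb _) (esym (stabE _)).
  by have [h [fK hK]] := bij_gmap_inv bf; exists (f, h).
have [t /all_and3[tK tK' tE]] := fin_all_exists tauP.
have tJ u g : (t u).1 (gact B b0 g) = gact B (val u) g by rewrite gfunJ tE.
have one_proof : r b0 == r b0 by [].
pose one : D := exist _ b0 one_proof.
constructor; apply: (@Deck _ _ r D one (fun u => (t u).1) (fun u => (t u).2)) => //.
- move=> u b; have [g ->] := tr b; rewrite tJ !gfunJ.
  by rewrite (eqP (valP u)).
- move=> b b'; have [g ->] := tr b; have [g' ->] := tr b' => e.
  have uP : r (gact B b0 (g' * g^-1)%g) == r b0.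
    by rewrite actM gfunJ -e gfunJ actK.
  exists (exist (fun b => r b == r b0) _ uP); rewrite tJ /= -actM.
  by rewrite -mulgA mulVg mulg1.
- move=> u v b; have [g ->] := tr b; rewrite !tJ => /act_inj.
  exact: val_inj.
- move=> b; apply: (can_inj (tK one)); rewrite tK'.
  by have [g ->] := tr b; rewrite tJ.
Qed.

Section DeckFind.
Variables (B Y : gset G) (r : gmap B Y) (d : deck r).

(** The index of the automorphism carrying b to b'; the default value occurs
    when b and b' lie in different fibres. *)
Definition deck_find (b b' : B) : d :=
  odflt (deck_one d) [pick u | deck_map u b == b'].

Lemma deck_findP b b' : r b = r b' -> deck_map (deck_find b b') b = b'.
Proof.
move=> /(deck_reach d)[u uE]; rewrite /deck_find; case: pickP => [v /eqP //|/(_ u)].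
by rewrite uE eqxx.
Qed.

Lemma deck_findJ b b' g : deck_find (gact B b g) (gact B b' g) = deck_find b b'.
Proof.
congr odflt; apply: eq_pick => u.
by rewrite gfunJ (inj_eq (act_inj _ _)).
Qed.

Lemma deck_find_map u b : deck_find b (deck_map u b) = u.
Proof. by apply: (@deck_free _ _ _ d _ _ b); rewrite deck_findP ?deck_over. Qed.

End DeckFind.

(** * Elementary symmetric bispans *)

Section Elementary.
Local Open Scope ring_scope.
Variables (X B Y Q : gset G) (p : gmap Q X) (q : gmap Q B) (r : gmap B Y).

(** The pairs (y, U) with U an i-element subset of the fibre over y; y is
    recorded because it is not determined by U when i = 0. *)
Definition fibre_subset i (w : gprod Y (gpowerset B)) : bool :=
  (#|(w.2 : {set B})| == i) && [forall b in (w.2 : {set B}), r b == w.1].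

Fact fibre_subset_stable i : gstable (fibre_subset i).
Proof.
apply: gstableW => -[y U] g /andP[/= cU /forall_inP rU]; rewrite /fibre_subset /=.
rewrite card_setact cU /=; apply/forall_inP => _ /imsetP[b bU ->].
by rewrite gfunJ (eqP (rU b bU)).
Qed.
Definition fibre_subsets i : gset G := gsub (@fibre_subset_stable i).

(** Over (y, U) the monomial is the product of the fibres of Q at the points
    of U. *)
Definition lies_in i (v : gprod (fibre_subsets i) Q) : bool :=
  q v.2 \in ((val v.1).2 : {set B}).

Fact lies_in_stable i : gstable (@lies_in i).
Proof.
apply: gstableW => -[U a] g aU; rewrite /lies_in /= gfunJ.
exact: mem_setact.
Qed.

(** The i-th elementary symmetric function of the conjugates of the monomial of
    (p, q), descended to Y. *)
Definition elementary i : bispan X Y :=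
  @Bispan G X Y (gsub (@lies_in_stable i)) (fibre_subsets i)
    (gcomp (gincl _) (gcomp (gsnd _ _) p)) (gcomp (gincl _) (gfst _ _))
    (gcomp (gincl _) (gfst _ _)).

Variable d : deck r.

(** The fibre of this monomial at b is the fibre of Q at [deck_map u b]. *)
Definition conjugate (u : d) : bispans X B := monomial p (gcomp q (deck_inv u)).

(** All conjugates at once: on the copy of Q with index u this is the structure
    map of [conjugate u]. *)
Definition spread : gmap (gprod (gtriv G d) Q) B.
Proof.
by exists (fun v => deck_inv v.1 (q v.2)) => v g; rewrite /= !gfunJ.
Defined.

Lemma fst_stable (P : pred d) :
  gstable (fun v : gprod (gtriv G d) Q => P v.1).
Proof. by []. Qed.

Lemma prod_conjugates (S : seq d) : uniq S ->
  \prod_(u <- S) conjugate u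
  = monomial (gcomp (gincl (fst_stable (mem S))) (gcomp (gsnd _ _) p))
             (gcomp (gincl (fst_stable (mem S))) spread).
Proof.
elim: S => [_|u S IH /= /andP[uS uniqS]].
  by rewrite big_nil monomial_empty // => -[].
rewrite big_cons IH //.
rewrite [RHS](monomial_split _ _ _ (fst_stable (pred1 u)) (fst_stable (mem S))).
- congr (_ * _); apply/esym.
  apply: (@monomial_iso _ _ _ _ _ _ _ _ _
            (gcomp (gincl (fst_stable (pred1 u))) (gsnd _ _))) => //.
    apply: inj_surj_bij => [[[v a] /= e] [[v' a'] /= e'] /= E|a].
      by apply: val_inj; rewrite /= (eqP e) (eqP e') E.
    by exists (exist _ (u, a) (eqxx _)).
  by move=> [[v a] /= /eqP ->].
- by move=> [v a]; rewrite /= inE.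
- by move=> [v a] /= /eqP ->.
Qed.

Definition pullback_elementary i := brestrict r (elementary i).
Local Notation E := pullback_elementary.

(** A point of the restriction of [elementary i] is an i-element subset of the
    fibre of r through a chosen base point b.  Since the automorphisms act
    simply transitively on that fibre, the subset amounts to a set of indices,
    and the latter is G-invariant: this trivializes the restriction as a
    disjoint union of copies of B, one for each i-element set of indices. *)
Definition shape i (w : bB (E i)) : {set d} :=
  [set u | deck_map u (val w).2 \in ((val (val w).1).2 : {set B})].

Lemma shapeJ i w g : shape (gact (bB (E i)) w g) = shape w.
Proof.
apply/setP => u; rewrite !inE /= gfunJ /=.
apply: (@mem_imset _ _ (fun b => gact B b g)) => //.
exact: act_inj.
Qed.

Lemma shape_stable i U : gstable (fun w : bB (E i) => shape w == U).
Proof. by move=> w g; rewrite shapeJ. Qed.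

Lemma subset_of_shape i (w : bB (E i)) :
  (val (val w).1).2 = [set deck_map u (val w).2 | u in shape w].
Proof.
case: w => [[[[y U] /= HU] b] /= e].
rewrite /shape /=; have /andP[_ /forall_inP rU] := HU.
apply/setP => b'; apply/idP/imsetP => [b'U|[u]]; last by rewrite inE => uU ->.
have eb : r b = r b' by rewrite -(eqP e); apply/esym/eqP/rU.
by exists (deck_find d b b'); rewrite ?inE deck_findP.
Qed.

Lemma card_shape i (w : bB (E i)) : #|shape w| = i.
Proof.
have /andP[/eqP cw _] := valP (val w).1.
rewrite -[RHS]cw subset_of_shape card_imset // => u v; exact: deck_free.
Qed.

Lemma shape_inj i (w w' : bB (E i)) :
  shape w = shape w' -> (val w).2 = (val w').2 -> w = w'.
Proof.
move=> es eb; apply: val_inj; rewrite [LHS]surjective_pairing [RHS]surjective_pairing.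
congr pair => //; apply: val_inj.
rewrite [LHS]surjective_pairing [RHS]surjective_pairing; congr pair; last first.
  by rewrite !subset_of_shape es eb.
rewrite (eqP (valP w) : (val (val w).1).1 = _).
by rewrite (eqP (valP w') : (val (val w').1).1 = _) eb.
Qed.

Lemma shape_surj i (U : {set d}) b : #|U| = i ->
  exists2 w : bB (E i), shape w = U & (val w).2 = b.
Proof.
move=> cU; pose V := [set deck_map u b | u in U].
have HV : fibre_subset i (r b, V).
  rewrite /fibre_subset /= card_imset ?cU ?eqxx /=; last by move=> u v; apply: deck_free.
  by apply/forall_inP => _ /imsetP[u _ ->]; rewrite deck_over.
pose V' : fibre_subsets i := exist (fun w => fibre_subset i w) (r b, V) HV.
have e : br (elementary i) V' == r b by [].
exists (exist _ (V', b) e) => //.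
apply/setP => u; rewrite inE; apply: (@mem_imset _ _ (fun v => deck_map v b)).
by move=> v v'; apply: deck_free.
Qed.

Lemma shape_base_bij i (U : {set d}) : #|U| = i ->
  bijective (br (bsub (@shape_stable i U))).
Proof.
move=> cU; apply: inj_surj_bij.
  move=> [w wU] [w' wU'] eb; apply: val_inj; apply: shape_inj => //=.
  by rewrite (eqP wU) (eqP wU').
move=> b; have [w ws wb] := @shape_surj i U b cU.
have wU : shape w == U by rewrite ws.
by exists (exist _ w wU).
Qed.

(** The same trivialization for the source of the bispan: a point a of Q over
    the fibre of the base point b, together with the index moving b to q a. *)
Definition label i (v : bA (E i)) : gprod (gtriv G d) Q :=
  (deck_find d (val v).2 (q (val (val v).1).2), (val (val v).1).2).

Lemma labelJ i v g : label (gact (bA (E i)) v g) = gact _ (label v) g.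
Proof. by congr pair; rewrite -[RHS](deck_findJ d _ _ g) -gfunJ. Qed.

Lemma label_map i (v : bA (E i)) : deck_map (label v).1 (val v).2 = q (label v).2.
Proof.
rewrite /label /= deck_findP //; case: v => -[[[[[y V] /= HV] a] /= aV] b] /= e.
have /andP[_ /forall_inP rV] := HV.
by rewrite -(eqP e); apply/esym/eqP/rV.
Qed.

Lemma spread_label i (v : bA (E i)) : spread (label v) = (val v).2.
Proof. by rewrite -[LHS]/(deck_inv (label v).1 (q (label v).2)) -label_map deck_mapK. Qed.

Lemma label_shape i (v : bA (E i)) : (label v).1 \in shape (bq (E i) v).
Proof.
rewrite in_set.
have -> : deck_map (label v).1 (val (bq (E i) v)).2 = q (label v).2.
  exact: label_map.
exact: (valP (val v).1).
Qed.

Lemma label_inj i (v v' : bA (E i)) :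
  label v = label v' -> shape (bq (E i) v) = shape (bq (E i) v') -> v = v'.
Proof.
move=> el es.
have eb : (val v).2 = (val v').2 by rewrite -!spread_label el.
have ew := shape_inj es eb.
apply: val_inj; rewrite [LHS]surjective_pairing [RHS]surjective_pairing eb.
congr pair; apply: val_inj.
rewrite [LHS]surjective_pairing [RHS]surjective_pairing; congr pair.
  exact: (congr1 (fun w => (val w).1) ew).
exact: (congr1 snd el).
Qed.

Lemma label_surj i (w : bB (E i)) (x : gprod (gtriv G d) Q) :
  x.1 \in shape w -> deck_map x.1 (val w).2 = q x.2 ->
  exists2 v, bq (E i) v = w & label v = x.
Proof.
case: x => u a /= uw e.
have aw : lies_in ((val w).1, a) by rewrite in_set e in uw.
pose a' : bA (elementary i) := exist (fun v => lies_in v) ((val w).1, a) aw.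
have ew : gcomp (bq (elementary i)) (br (elementary i)) a' == r (val w).2.
  exact: (valP w).
exists (exist _ (a', (val w).2) ew).
  by apply: val_inj; apply: (esym (surjective_pairing (val w))).
by congr pair; rewrite -[LHS]/(deck_find d (val w).2 (q a)) -e deck_find_map.
Qed.

(** On the piece of shape U the target leg is bijective, so the piece is a
    monomial, and its labels run through the copies of Q indexed by U. *)
Lemma shape_class i (U : {set d}) : #|U| = i ->
  bclass (bsub (@shape_stable i U)) = \prod_(u in U) conjugate u.
Proof.
move=> cU; rewrite -big_enum prod_conjugates ?enum_uniq //.
rewrite (bclass_monomial (shape_base_bij cU)).
have labelU (v : bA (bsub (@shape_stable i U))) : (label (val v)).1 \in enum U.
  have /eqP vU : shape (bq (E i) (val v)) == U := valP v.
  by rewrite mem_enum; have := label_shape (val v); rewrite vU.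
pose f (v : bA (bsub (@shape_stable i U))) : gsub (fst_stable (mem (enum U))) :=
  exist _ (label (val v)) (labelU v).
have fJ v g : f (gact _ v g) = gact _ (f v) g.
  by apply: val_inj; apply: labelJ.
apply: (@monomial_iso _ _ _ _ _ _ _ _ _ (GMap fJ)) => [||v].
- apply: inj_surj_bij => [[v vU] [v' vU'] /(congr1 val) el|[x xU]].
    apply: val_inj; apply: (label_inj el).
    by rewrite (eqP vU) (eqP vU').
  have [w ws wb] := @shape_surj i U (spread x) cU.
  have xw : x.1 \in shape w by rewrite ws -mem_enum.
  have [|v vw vx] := label_surj xw; first by rewrite wb deck_invK.
  have vU : shape (bq (E i) v) == U by rewrite vw ws.
  by exists (exist _ v vU); apply: val_inj.
- by [].
- exact: spread_label (val v).
Qed.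

(** The restriction is a genuine elementary symmetric polynomial, although the
    conjugates themselves exist only over B. *)
Lemma restrict_elementary i :
  bclass (brestrict r (elementary i))
  = \sum_(U : {set d} | #|U| == i) \prod_(u in U) conjugate u.
Proof.
rewrite (bclass_fibres (@shapeJ i) (@shape_stable i)).
rewrite [RHS]big_mkcond; apply: eq_bigr => U _.
case: eqP => [/shape_class //|cU]; apply: bclass_empty => -[w /= /eqP wU].
by case: cU; rewrite -wU card_shape.
Qed.

Lemma conjugate_one : conjugate (deck_one d) = monomial p q.
Proof.
apply: (@monomial_iso _ _ _ _ _ _ _ _ _ (gid Q)) => //; first by exists id.
by move=> a; rewrite /= deck_inv_one.
Qed.

End Elementary.
End Decks.

(** * Finite generation *)

Section Finiteness.
Local Open Scope ring_scope.
Variable G : finGroupType.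
Implicit Types A B X Y Q : gset G.

Record span X B := Span {
  span_apex : gset G;
  span_left : gmap span_apex X;
  span_right : gmap span_apex B
}.

Definition span_monomial X B (s : span X B) : bispans X B :=
  monomial (span_left s) (span_right s).

(** A pointed transitive span is determined up to isomorphism by the stabilizer
    of its base point and the images of that point. *)
Definition orbit_type X B : finType := ({set G} * X * B)%type.

(** Finitely many spans suffice because there are finitely many types; a type
    that does not occur is given the empty span. *)
Lemma orbit_representatives X B :
  exists rep : orbit_type X B -> span X B,
    forall Q (p : gmap Q X) (q : gmap Q B) (a0 : Q), transitive_from a0 ->
      monomial p q = span_monomial (rep (stab a0, p a0, q a0)).
Proof.
pose has_type (k : orbit_type X B) (s : span X B) := exists a0 : span_apex s,
  transitive_from a0 /\ (stab a0, span_left s a0, span_right s a0) = k.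
have /fin_all_exists[rep repE] k :
    exists s : span X B, (exists t, has_type k t) -> has_type k s.
  have [[s Hs]|none] := pselect (exists s, has_type k s); first by exists s.
  exists (Span (gfrom_empty X) (gfrom_empty B)) => -[t Ht].
  by case: none; exists t.
exists rep => Q p q a0 tr; set k := (_, _, _).
have [|b0 [trb [es ep eq]]] := repE k.
  by exists (Span p q), a0.
have [f [bf fE]] := orbit_gmap_bij tr trb (esym es).
apply: (@monomial_iso _ _ _ _ _ _ _ _ _ f bf).
  by apply: (@gmap_eq_transitive _ _ _ _ (gcomp f _) p tr); rewrite /= fE.
by apply: (@gmap_eq_transitive _ _ _ _ (gcomp f _) q tr); rewrite /= fE.
Qed.

Lemma monomial_factors X B (rep : orbit_type X B -> span X B) :
  (forall Q (p : gmap Q X) (q : gmap Q B) (a0 : Q), transitive_from a0 ->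
      monomial p q = span_monomial (rep (stab a0, p a0, q a0))) ->
  forall Q (p : gmap Q X) (q : gmap Q B),
    exists m : orbit_type X B -> nat,
      monomial p q = \prod_k span_monomial (rep k) ^+ m k.
Proof.
move=> repE Q p q; have [n] := ubnP #|Q|; elim: n Q p q => // n IH Q p q /ltnSE leQ.
have [a0 _|Q0] := pickP (predT : pred Q); last first.
  exists (fun=> 0%N); rewrite big1 // monomial_empty // => a.
  by have := Q0 a.
have [|m mE] := IH _ (gcomp (gincl (off_orbit_stable a0)) p)
                     (gcomp (gincl (off_orbit_stable a0)) q).
  exact: leq_trans (card_off_orbit a0) leQ.
have := repE _ (gcomp (gincl (in_orbit_stable a0)) p)
               (gcomp (gincl (in_orbit_stable a0)) q) _ (@orbit_transitive G Q a0).
set k0 := (_, _, _) => k0E.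
exists (fun k => (k == k0) + m k)%N.
rewrite -(@monomial_true _ _ _ _ p q _ (@gstable_true G Q)) //.
rewrite (monomial_split p q (@gstable_true G Q) (in_orbit_stable a0)
  (off_orbit_stable a0)); last 2 first.
- by move=> a; rewrite /= orbN.
- by move=> a /= ->.
rewrite k0E mE (bigD1 k0) //= [RHS](bigD1 k0) //= eqxx add1n exprS mulrA.
by congr (_ * _); apply: eq_bigr => k /negbTE ->.
Qed.

Definition to_ring X Y (c : bispans X Y) : free_tambara X Y := completion_of c 0.

Lemma to_ringD X Y : {morph @to_ring X Y : c d / c + d}.
Proof.
move=> c d; apply/esym; rewrite /to_ring [LHS]completion_addE.
by rewrite addr0.
Qed.

Lemma to_ringM X Y : {morph @to_ring X Y : c d / c * d}.
Proof.
move=> c d; apply/esym; rewrite /to_ring [LHS]completion_mulE.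
by rewrite mulr0 mul0r mulr0 !addr0.
Qed.

Lemma completion_ofB X Y (c d : bispans X Y) :
  completion_of c d = to_ring c - to_ring d :> free_tambara X Y.
Proof.
apply/esym; rewrite /to_ring.
have -> : - completion_of d 0 = completion_of 0 d :> free_tambara X Y.
  exact: completion_oppE.
by rewrite [LHS]completion_addE addr0 add0r.
Qed.

(** Frobenius reciprocity turns the symmetric function of the conjugates,
    acting over B, into multiplication by a single element over Y. *)
Lemma elementary_action X B Y Q (p : gmap Q X) (q : gmap Q B) (r : gmap B Y)
    (d : deck r) i (w : bispans X B) :
  \sum_(U : {set d} | #|U| == i)
     to_ring (transfer r (\prod_(u in U) conjugate p q u * w))
  = to_ring (bclass (elementary p q r i)) * to_ring (transfer r w).
Proof.
rewrite -to_ringM frobenius (restrict_elementary p q d) mulr_suml.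
have t0 : to_ring (transfer r 0) = 0 :> free_tambara X Y by rewrite transfer0.
have tD : {morph (fun c => to_ring (transfer r c) : free_tambara X Y) : c c' / c + c'}.
  by move=> c c'; rewrite transferD to_ringD.
by rewrite (big_morph _ tD t0).
Qed.

(** The generators are the elementary symmetric functions of the representative
    monomials and the transfers of their products with all exponents below the
    degree n of the covering. *)
Lemma transfers_finite (dedG : dedekind G) X B Y (r : gmap B Y) (b0 : B) :
  transitive_from b0 ->
  exists s : seq (free_tambara X Y), forall S : {pred free_tambara X Y},
    GRing.subring_closed S -> {subset s <= S} ->
    forall Q (p : gmap Q X) (q : gmap Q B), to_ring (transfer r (monomial p q)) \in S.
Proof.
move=> /(dedekind_deck dedG r)[d].
have [rep repE] := orbit_representatives X B.
pose n := #|d|.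
pose e k i : free_tambara X Y :=
  to_ring (bclass (elementary (span_left (rep k)) (span_right (rep k)) r i)).
pose mono (m : orbit_type X B -> nat) : free_tambara X Y :=
  to_ring (transfer r (\prod_k span_monomial (rep k) ^+ m k)).
exists ([seq e ki.1 ki.2.+1 | ki : orbit_type X B * 'I_n]
   ++ [seq mono (fun k => m k) | m : {ffun orbit_type X B -> 'I_n}]).
move=> S Sring sS Q p q; have [m ->] := monomial_factors repE p q.
apply: (monomials_in_subring (f := fun c => to_ring (transfer r c)) (n := n) (e := e) Sring).
- move=> k i; apply: sS; rewrite mem_cat; apply/orP; left.
  exact: (image_f (fun ki : _ * 'I_n => e ki.1 ki.2.+1) (x := (k, i))).
- move=> k z; have := vieta_relation (f := fun c => to_ring (transfer r c)) (deck_one d)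
    (elementary_action (span_left (rep k)) (span_right (rep k)) d) z.
  by rewrite conjugate_one.
- move=> m'; apply: sS; rewrite mem_cat; apply/orP; right.
  exact: (image_f (fun m : {ffun _ -> 'I_n} => mono (fun k => m k))).
Qed.

Lemma transfer_monomial X B Y Q (p : gmap Q X) (q : gmap Q B) (r : gmap B Y) :
  transfer r (monomial p q) = bclass (Bispan p q r).
Proof.
rewrite transfer_class; apply/bclassP.
by exists (gid _), (gid _); split=> //; exists id.
Qed.

(** The middle object of a bispan is only known up to isomorphism; all those
    with the same stabilizer and the same image of the base point are moved to
    one chosen model, to which the previous lemma applies. *)
Lemma transitive_finite (dedG : dedekind G) X Y (k : {set G} * Y) :
  exists s : seq (free_tambara X Y), forall S : {pred free_tambara X Y},
    GRing.subring_closed S -> {subset s <= S} ->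
    forall (t : bispan X Y) (b0 : bB t), transitive_from b0 ->
      (stab b0, br t b0) = k -> to_ring (bclass t) \in S.
Proof.
have [[B [r [b0 [tr bk]]]]|none] := pselect (exists (B : gset G)
  (r : gmap B Y) (b0 : B), transitive_from b0 /\ (stab b0, r b0) = k).
- have [s sE] := transfers_finite dedG X r tr.
  exists s => S Sring sS t c0 trc ck.
  have [es' er'] : (stab b0, r b0) = (stab c0, br t c0) by rewrite bk ck.
  have [f [bf fE]] := orbit_gmap_bij trc tr (esym es').
  have -> : bclass t = transfer r (monomial (bp t) (gcomp (bq t) f)).
    rewrite transfer_monomial; apply/bclassP; exists (gid _), f; split=> //.
      by exists id.
    by apply: (@gmap_eq_transitive _ _ _ _ (gcomp f r) (br t) trc); rewrite /= fE.
  exact: sE.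
- exists [::] => S _ _ t b0 tr bk; case: none.
  by exists (bB t), (br t), b0.
Qed.

(** Orbits of the middle object are split off one at a time. *)
Theorem free_tambara_fingen (dedG : dedekind G) X Y :
  fingen_Zalgebra (free_tambara X Y).
Proof.
have /fin_all_exists[gens gensE] := @transitive_finite dedG X Y.
exists (flatten [seq gens k | k : {set G} * Y]) => S Sring sS.
have [S0 SD] := GRing.zmod_closedD (GRing.subring_closedB Sring).
have [_ SB _] := Sring.
suff main (t : bispan X Y) : to_ring (bclass t) \in S.
  elim/completionW => c d; rewrite completion_ofB -(bclass_repr c) -(bclass_repr d).
  exact: SB.
have [n] := ubnP #|bB t|; elim: n t => // n IH t /ltnSE let_.
have [b0 _|B0] := pickP (predT : pred (bB t)); last first.
  by rewrite bclass_empty // => b; have := B0 b.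
rewrite -(@bsub_true _ _ _ t _ (@gstable_true G (bB t))) //.
rewrite (bsub_split _ (in_orbit_stable b0)
  (off_orbit_stable b0)); last 2 first.
- by move=> b; rewrite /= orbN.
- by move=> b /= ->.
rewrite to_ringD; apply: SD; last first.
  by apply: IH; apply: leq_trans (card_off_orbit b0) let_.
pose k0 := (stab (orbit_point b0), br (bsub (in_orbit_stable b0)) (orbit_point b0)).
apply: (gensE k0 S Sring _ (bsub (in_orbit_stable b0)) (orbit_point b0)) => //;
  last exact: orbit_transitive.
move=> x xg; apply: sS; apply/flattenP; exists (gens k0) => //.
exact: image_f.
Qed.

End Finiteness.

Theorem theoremA (G : finGroupType) (dedG : dedekind G) : tambara_finite G.
Proof. by move=> X L; apply: free_tambara_fingen. Qed.
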